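(* Fix an integer $\delta\ge1$. There is a constant $K_\delta$ such that for every $L$ the following holds on the $3$-dimensional nearest-neighbour qubit lattice $\{0,\dots,L-1\}^3$ ($N=L^3$). Let $P$ be the set of unordered pairs $\{x,y\}$ of distinct sites with $\|x-y\|_\infty\le\delta$, and for each $\{x,y\}\in P$ let $H_{xy}$ be any Hermitian, fermion-parity-even operator in the algebra generated by $c_x,c_y,c_x^\dagger,c_y^\dagger$, and $\theta_{xy}\in\mathbb R$. Then there exist canonical orderings $m_0,m_1$, an enumeration $p_1,\dots,p_{|P|}$ of $P$, and a circuit $V$ of at most $K_\delta N$ single-qubit gates and nearest-neighbour CNOT gates, of depth at most $K_\delta L=K_\delta N^{1/3}$, such that $V\Phi_{m_0}=\Phi_{m_1}\,e^{-i\theta_{p_{|P|}}H_{p_{|P|}}}\cdots e^{-i\theta_{p_1}H_{p_1}}$.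
   Context: Qubits sit on $\{0,\dots,L-1\}^3$; two-qubit gates are allowed only between sites at $\ell_1$-distance 1. There is one fermionic mode per site with ladder operators $c_x,c_x^\dagger$, $n_x=c_x^\dagger c_x$; parity-even means commuting with $(-1)^{n_x+n_y}$. A canonical ordering is a bijection $m$ from sites to $\{0,\dots,N-1\}$. The JW isometry $\Phi_m$ is the unique unitary from Fock space to the $N$-qubit space with $\Phi_m|\mathrm{vac}\rangle=|0\cdots0\rangle$ and $\Phi_mc_x\Phi_m^\dagger=\tfrac12(X_x+iY_x)\prod_{y:m(y)<m(x)}Z_y$. *)

(* Defs.v *)
From mathcomp Require Import all_boot all_order all_algebra.
From mathcomp Require Import complex Rstruct.
Set Implicit Arguments. Unset Strict Implicit. Unset Printing Implicit Defensive.
Import GRing.Theory Num.Theory.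
Local Open Scope ring_scope.

Definition RR : rcfType := Rdefinitions.R.
Definition C : numClosedFieldType := RR[i].
Definition iC : C := Complex 0 1.
Definition ofR (t : RR) : C := Complex t 0.

Definition site (L : nat) : finType := ('I_L * 'I_L * 'I_L)%type.
Definition absd (a b : nat) : nat := ((a - b) + (b - a))%N.
Definition linf L (x y : site L) : nat :=
  maxn (maxn (absd x.1.1 y.1.1) (absd x.1.2 y.1.2)) (absd x.2 y.2).
Definition l1 L (x y : site L) : nat :=
  (absd x.1.1 y.1.1 + absd x.1.2 y.1.2 + absd x.2 y.2)%N.

Definition canonical_ordering L (m : site L -> 'I_(L ^ 3)) : Prop := bijective m.

(* Computational basis (qubits) and occupation-number basis (Fock space)
   are both indexed by configurations site -> bool. *)
Definition cfg L : finType := {ffun site L -> bool}.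
Definition dim L : nat := #|{: cfg L}|.
Definition Op L := 'M[C]_(dim L).
Definition Vec L := 'cV[C]_(dim L).

Definition mxOf L (f : cfg L -> cfg L -> C) : Op L :=
  \matrix_(i, j) f (enum_val i) (enum_val j).
Definition ket L (n : cfg L) : Vec L := \col_i (enum_val i == n)%:R.
Definition allzero L : cfg L := [ffun => false].
Definition flip L (b : cfg L) (x : site L) : cfg L :=
  [ffun z => if z == x then ~~ b z else b z].

Definition adj n (A : 'M[C]_n) : 'M[C]_n := (map_mx Num.conj A)^T.
Definition is_unitary n (U : 'M[C]_n) : Prop :=
  U *m adj U = 1%:M /\ adj U *m U = 1%:M.
Definition is_hermitian n (A : 'M[C]_n) : Prop := adj A = A.
Definition mxpow n (A : 'M[C]_n) (k : nat) : 'M[C]_n := iter k (mulmx A) 1%:M.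

Definition is_expm n (A E : 'M[C]_n) : Prop :=
  forall e : C, 0 < e -> exists N : nat, forall k : nat, (N <= k)%N ->
    forall i j, `| (\sum_(l < k) (l`!%:R)^-1 *: mxpow A l) i j - E i j | < e.

(* ---------- fermions: a concrete model of Fock space ----------
   Basis |n> = prod (c_x^dag)^{n_x} |vac>, product taken in the reference
   order given by enum_rank; vacuum = all-unoccupied configuration. *)
Definition c_op L (x : site L) : Op L :=
  mxOf (fun a b => if b x && (a == flip b x)
                   then (-1) ^+ #|[set y | (enum_rank y < enum_rank x)%N && b y]|
                   else 0).
Definition cdag L (x : site L) : Op L := adj (c_op x).
Definition num_op L (x : site L) : Op L := cdag x *m c_op x.
(* (-1)^{n_x + n_y} *)
Definition parity2 L (x y : site L) : Op L :=
  (1%:M - 2%:R *: num_op x) *m (1%:M - 2%:R *: num_op y).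
Definition parity_even L (x y : site L) (H : Op L) : Prop :=
  parity2 x y *m H = H *m parity2 x y.

Definition in_gen_algebra L (gens : seq (Op L)) (H : Op L) : Prop :=
  exists s : seq (C * seq (Op L)),
    all (fun w => all (fun g => g \in gens) w.2) s /\
    H = \sum_(w <- s) w.1 *: foldr mulmx 1%:M w.2.

Definition bit (b : bool) : 'I_2 := inord b.
Definition onsite L (x : site L) (U : 'M[C]_2) : Op L :=
  mxOf (fun a b => if [forall y, (y != x) ==> (a y == b y)]
                   then U (bit (a x)) (bit (b x)) else 0).
Definition PX : 'M[C]_2 := \matrix_(i < 2, j < 2) (if i != j then 1 else 0).
Definition PY : 'M[C]_2 := \matrix_(i < 2, j < 2)
  (if ((i : nat) == 0%N) && ((j : nat) == 1%N) then - iC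
   else if ((i : nat) == 1%N) && ((j : nat) == 0%N) then iC else 0).
Definition PZ : 'M[C]_2 := \matrix_(i < 2, j < 2)
  (if i == j then (if (i : nat) == 0%N then 1 else -1) else 0).

Definition Zstring L (m : site L -> 'I_(L ^ 3)) (x : site L) : Op L :=
  foldr mulmx 1%:M [seq onsite y PZ | y <- enum [pred y | (m y < m x)%N]].

Definition isJW L (m : site L -> 'I_(L ^ 3)) (Phi : Op L) : Prop :=
  is_unitary Phi /\
  Phi *m ket (allzero L) = ket (allzero L) /\
  forall x : site L,
    Phi *m c_op x *m adj Phi =
    ((2%:R : C)^-1 *: (onsite x PX + iC *: onsite x PY)) *m Zstring m x.

Inductive gate (L : nat) : Type :=
| Gate1 of site L & 'M[C]_2
| CNOT of site L & site L.          (* control, target *)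

Definition gate_valid L (g : gate L) : Prop :=
  match g with
  | Gate1 _ U => is_unitary U
  | CNOT x y => l1 x y = 1%N
  end.
Definition gate_support L (g : gate L) : {set site L} :=
  match g with
  | Gate1 x _ => [set x]
  | CNOT x y => [set x; y]
  end.
Definition gate_op L (g : gate L) : Op L :=
  match g with
  | Gate1 x U => onsite x U
  | CNOT x y => mxOf (fun a b => (a == (if b x then flip b y else b))%:R)
  end.

Definition layer L := seq (gate L).
Definition layer_ok L (l : layer L) : Prop :=
  (forall g, List.In g l -> gate_valid g) /\
  pairwise (fun g h => [disjoint gate_support g & gate_support h]) l.
Definition layer_op L (l : layer L) : Op L := foldr (fun g acc => gate_op g *m acc) 1%:M l.

Definition circuit L := seq (layer L).
Definition circuit_ok L (c : circuit L) : Prop := forall l, List.In l c -> layer_ok l.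
Definition circuit_op L (c : circuit L) : Op L :=
  foldl (fun acc l => layer_op l *m acc) 1%:M c.
Definition circuit_depth L (c : circuit L) : nat := size c.
Definition gate_count L (c : circuit L) : nat := sumn (map size c).

Definition inP (δ : nat) L (p : {set site L}) : bool :=
  [exists x, exists y, [&& x != y, (linf x y <= δ)%N & p == [set x; y]]].
Definition enumerates (δ : nat) L (s : seq {set site L}) : Prop :=
  uniq s /\ forall p, (p \in s) = inP δ p.
Definition ordered_prod L (E : {set site L} -> Op L) (s : seq {set site L}) : Op L :=
  foldl (fun acc p => E p *m acc) 1%:M s.

(* Main.v *)
Require Import Defs.
From mathcomp Require Import all_boot all_order all_algebra.
From mathcomp Require Import complex Rstruct.
From mathcomp Require Import zify ring.
Import Order.TTheory GRing.Theory Num.Theory.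
Local Open Scope ring_scope.

(* Both canonical orderings are the reference order r0, which is lexicographic;
   then the Jordan-Wigner isometry commutes with all pair gates, and it suffices
   to build a circuit for their product.

   Put B = delta + 1. For each shift t in [0,B)^3 the lattice is cut into blocks
   of side B, and every pair lies in one block for some t. Reordering the modes
   from r0 to the order rb in which blocks are contiguous is the diagonal sign
   D_t = (-1)^q, where q(b) sums b_z b_w over the inversions of rb against r0.
   Once the parities of all lines in the third direction are collected in one
   plane, the inversions couple only parallel lines at distance O(B), through
   sums b_z * (parity of the tail of the other line beyond z); a CNOT ladder
   produces all tail parities of a line, so D_t has O(N) gates and depth O(L). In D_t E D_t
   the Jordan-Wigner string of a pair stays inside its block, so each pair costs
   O(1) gates and all blocks run in parallel.

   The only facts used about E = exp(-i theta H) are that it is unitary and that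
   it commutes with the parity of the pair, with every n_z, and with (parity of
   the pair) * (c_z + c_z^dag), for every third mode z. *)

Set Implicit Arguments.
Unset Strict Implicit.
Unset Printing Implicit Defensive.

Notation "\xor_ ( i <- r | P ) F" := (\big[addb/false]_(i <- r | P%B) F%B)
  (at level 41, F at level 41, i, r at level 50).
Notation "\xor_ ( i <- r ) F" := (\big[addb/false]_(i <- r) F%B)
  (at level 41, F at level 41, i, r at level 50).
Notation "\xor_ ( i | P ) F" := (\big[addb/false]_(i | P%B) F%B)
  (at level 41, F at level 41, i at level 50).
Notation "\xor_ i F" := (\big[addb/false]_i F%B)
  (at level 41, F at level 41, i at level 0).

(** In the lexicographic order two sites at distance at most [delta] can have about [L^2] modes
    between them, so removing the string of every pair separately would take too many gates;
    regrouping the modes into blocks avoids this. The reordering sign has in turn about [N L^2]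
    inversions, too many to be applied one by one, which forces the summation along lines. The side
    [delta + 1] is the least one for which some shift puts any given pair of [P] into a single
    block. The free choice of the enumeration is what makes the scheme affordable: pairs are listed
    by shift and then by block, so that [D_t] is paid for twice per shift and not twice per pair,
    and different blocks of a stage occupy disjoint regions. Each stage undoes its own reordering,
    hence a single canonical ordering can serve at both ends. Bounds inside a block are deliberately
    crude, even exponential in the block volume, because only their independence of [L] matters. *)

Definition sgn (b : bool) : C := if b then -1 else 1.

Lemma sgnM a b : sgn a * sgn b = sgn (a (+) b).
Proof. by case: a; case: b; rewrite /sgn /= ?mulr1 ?mul1r ?mulrNN ?mulr1. Qed.

Lemma sgn_sq a : sgn a * sgn a = 1.
Proof. by rewrite sgnM addbb. Qed.

Lemma conj_sgn a : (sgn a)^* = sgn a.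
Proof. by case: a; rewrite /sgn ?rmorphN rmorph1. Qed.

Lemma sgn_exp n : (-1) ^+ n = sgn (odd n).
Proof. by rewrite -signr_odd; case: (odd n); rewrite ?expr0 ?expr1. Qed.

(** * Monomial operators *)

Section Entries.
Variable L : nat.
Implicit Types (A B U V : Op L) (a b c : cfg L) (x y z w : site L).

(** Entries are addressed by configurations instead of ordinals, so that matrix identities can be
    checked basis state by basis state. *)
Definition ent A a b : C := A (enum_rank a) (enum_rank b).

Lemma ent_mxOf f a b : ent (mxOf f) a b = f a b.
Proof. by rewrite /ent mxE !enum_rankK. Qed.

Lemma ent_ext A B : (forall a b, ent A a b = ent B a b) -> A = B.
Proof.
move=> h; apply/matrixP => i j.
by have := h (enum_val i) (enum_val j); rewrite /ent !enum_valK.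
Qed.

Lemma ent_mul A B a b : ent (A *m B) a b = \sum_c ent A a c * ent B c b.
Proof.
rewrite /ent mxE (reindex (@enum_rank (cfg L))) //=.
by exists enum_val => c _; rewrite ?enum_rankK ?enum_valK.
Qed.

Lemma ent1 a b : ent 1%:M a b = (a == b)%:R.
Proof. by rewrite /ent mxE (inj_eq enum_rank_inj). Qed.

Lemma ent_adj A a b : ent (adj A) a b = (ent A b a)^*.
Proof. by rewrite /ent !mxE. Qed.

Lemma adjM A B : adj (A *m B) = adj B *m adj A.
Proof. by rewrite /adj map_mxM trmx_mul. Qed.

Lemma adjK A : adj (adj A) = A.
Proof. by apply/matrixP => i j; rewrite !mxE conjCK. Qed.

Lemma flip_at b x : flip b x x = ~~ b x.
Proof. by rewrite ffunE eqxx. Qed.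

Lemma flip_ne b x z : z != x -> flip b x z = b z.
Proof. by rewrite ffunE => /negbTE->. Qed.

Lemma flipE b x z : flip b x z = (z == x) (+) b z.
Proof. by rewrite ffunE; case: eqP. Qed.

Lemma flipK x : involutive (fun b => flip b x).
Proof. by move=> b; apply/ffunP => z; rewrite !flipE addbA addbb. Qed.

Lemma flipC b x y : flip (flip b x) y = flip (flip b y) x.
Proof. by apply/ffunP => z; rewrite !flipE addbCA. Qed.

Lemma eq_flip a b x : (flip a x == b) = (a == flip b x).
Proof. by apply/eqP/eqP => [<-|->]; rewrite flipK. Qed.

(* The operator [|b> -> phi b |f b>]: CNOTs, diagonal phases, fermionic
   ladder operators and Pauli strings are all of this shape. *)
Definition Mn (f : cfg L -> cfg L) (phi : cfg L -> C) : Op L :=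
  mxOf (fun a b => if a == f b then phi b else 0).

Lemma ent_Mn f phi a b : ent (Mn f phi) a b = if a == f b then phi b else 0.
Proof. exact: ent_mxOf. Qed.

Lemma ent_mulMn A f phi a b : ent (A *m Mn f phi) a b = ent A a (f b) * phi b.
Proof.
rewrite ent_mul (bigD1 (f b)) //= ent_Mn eqxx big1 ?addr0 // => c /negbTE h.
by rewrite ent_Mn h mulr0.
Qed.

Lemma ent_Mnmul g f phi A a b : cancel f g -> cancel g f ->
  ent (Mn f phi *m A) a b = phi (g a) * ent A (g a) b.
Proof.
move=> fK gK; rewrite ent_mul (bigD1 (g a)) //= ent_Mn gK eqxx big1 ?addr0 // => c h.
rewrite ent_Mn; case: eqP => [e|]; last by rewrite mul0r.
by case/eqP: h; rewrite e fK.
Qed.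

Lemma MnM f phi g psi :
  Mn f phi *m Mn g psi = Mn (fun b => f (g b)) (fun b => phi (g b) * psi b).
Proof.
apply: ent_ext => a b; rewrite ent_mulMn !ent_Mn.
by case: eqP => //; rewrite mul0r.
Qed.

Lemma eq_Mn f phi g psi : (forall b, f b = g b) -> (forall b, phi b = psi b) ->
  Mn f phi = Mn g psi.
Proof. by move=> h1 h2; apply: ent_ext => a b; rewrite !ent_Mn h1 h2. Qed.

Lemma Mn1 : Mn id (fun=> 1) = 1%:M.
Proof. by apply: ent_ext => a b; rewrite ent_Mn ent1; case: eqP. Qed.

Definition Pm f : Op L := Mn f (fun=> 1).
Definition Dp phi : Op L := Mn id phi.
Definition Dg (q : cfg L -> bool) : Op L := Dp (fun b => sgn (q b)).

Lemma PmM f g : Pm f *m Pm g = Pm (fun b => f (g b)).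
Proof. by rewrite /Pm MnM; apply: eq_Mn => // b; rewrite mulr1. Qed.

Lemma DpM phi psi : Dp phi *m Dp psi = Dp (fun b => phi b * psi b).
Proof. by rewrite /Dp MnM. Qed.

Lemma DgM p q : Dg p *m Dg q = Dg (fun b => p b (+) q b).
Proof. by rewrite /Dg DpM; apply: eq_Mn => // b; rewrite sgnM. Qed.

Lemma eq_Dp p q : (forall b, p b = q b) -> Dp p = Dp q.
Proof. by move=> h; apply: eq_Mn => // b; rewrite h. Qed.

Lemma eq_Dg p q : (forall b, p b = q b) -> Dg p = Dg q.
Proof. by move=> h; apply: eq_Dp => b; rewrite h. Qed.

Lemma Dg0 : Dg (fun=> false) = 1%:M.
Proof. exact: Mn1. Qed.

Lemma DgK q : Dg q *m Dg q = 1%:M.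
Proof. by rewrite DgM -Dg0; apply: eq_Dg => b; rewrite addbb. Qed.

(** This is how CNOT circuits create phases in parities: a simple phase sandwiched between a
    reversible map and its inverse is evaluated at the image configuration. *)
Lemma Pm_conj f g phi : cancel f g -> Pm g *m Dp phi *m Pm f = Dp (fun b => phi (f b)).
Proof.
by move=> fK; rewrite /Pm /Dp !MnM; apply: eq_Mn => b //; rewrite mul1r mulr1.
Qed.

Lemma ent_Dp_l phi A a b : ent (Dp phi *m A) a b = phi a * ent A a b.
Proof. by rewrite (ent_Mnmul (g := id)). Qed.

Lemma ent_Dp_r phi A a b : ent (A *m Dp phi) a b = ent A a b * phi b.
Proof. by rewrite ent_mulMn. Qed.

Lemma adj_Dg q : adj (Dg q) = Dg q.
Proof.
apply: ent_ext => a b; rewrite ent_adj !ent_Mn eq_sym.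
by case: eqP => [->|]; rewrite ?conj_sgn ?rmorph0.
Qed.

Definition cn x y : cfg L -> cfg L := fun b => if b x then flip b y else b.

Lemma cnE x y b z : cn x y b z = ((z == y) && b x) (+) b z.
Proof. by rewrite /cn; case: (b x); rewrite ?flipE ?andbT ?andbF. Qed.

Lemma cn_eq x y b : cn x y b y = b x (+) b y.
Proof. by rewrite cnE eqxx. Qed.

Lemma cn_ne x y b z : z != y -> cn x y b z = b z.
Proof. by rewrite cnE => /negbTE->. Qed.

Lemma cnK x y : x != y -> involutive (cn x y).
Proof.
move=> xy b; apply/ffunP => z; rewrite !cnE (negbTE xy) /= addbA.
by case: (z == y); rewrite /= ?addbb.
Qed.

Lemma gate_op_CNOT x y : gate_op (CNOT x y) = Pm (cn x y).
Proof.
by apply: ent_ext => a b; rewrite ent_mxOf ent_Mn; case: eqP.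
Qed.

End Entries.

(** * Locality and parallel composition *)

Section Idle.
Variable L : nat.
Implicit Types (A B : Op L) (U : 'M[C]_2) (a b c : cfg L) (x y z w : site L) (S T : {set site L}).

(** Encodes that [A] acts as the identity on the qubit [z] without tensor factorisations: [A] is
    block diagonal in the bit at [z], with two equal blocks. *)
Definition idle z A := (forall a b, a z != b z -> ent A a b = 0) /\
  (forall a b, ent A (flip a z) (flip b z) = ent A a b).

Lemma idle1 z : idle z 1%:M.
Proof.
split=> a b; rewrite !ent1; last by rewrite eq_flip flipK.
by move=> h; case: eqP => // e; rewrite e eqxx in h.
Qed.

Lemma idleM z A B : idle z A -> idle z B -> idle z (A *m B).
Proof.
move=> [A0 A1] [B0 B1]; split=> a b; rewrite ?ent_mul.
  move=> h; rewrite big1 // => c _.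
  case: (eqVneq (a z) (c z)) => [e|/A0->]; last by rewrite mul0r.
  by rewrite B0 ?mulr0 // -e.
rewrite (reindex (fun c => flip c z)) /=; last by exists (fun c => flip c z) => c _; rewrite flipK.
by apply: eq_bigr => c _; rewrite A1 B1.
Qed.

Lemma idle_Mn z (f : cfg L -> cfg L) (phi : cfg L -> C) : (forall b, f b z = b z) -> (forall b, f (flip b z) = flip (f b) z) ->
  (forall b, phi (flip b z) = phi b) -> idle z (Mn f phi).
Proof.
move=> h1 h2 h3; split=> a b; rewrite !ent_Mn; last by rewrite h2 h3 (inj_eq (inv_inj (@flipK _ z))).
by move=> h; case: eqP => // e; rewrite e h1 eqxx in h.
Qed.

Lemma onsite_ent x U a b : ent (onsite x U) a b =
  if [forall y, (y != x) ==> (a y == b y)] then U (bit (a x)) (bit (b x)) else 0.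
Proof. exact: ent_mxOf. Qed.

Lemma idle_onsite z x U : z != x -> idle z (onsite x U).
Proof.
move=> zx; split=> a b.
  move=> h; rewrite onsite_ent; case: forallP => // /(_ z).
  by rewrite zx (negbTE h).
rewrite !onsite_ent !(flip_ne _ (x := z)) 1?eq_sym //.
suff -> : [forall y, (y != x) ==> (flip a z y == flip b z y)] = [forall y, (y != x) ==> (a y == b y)] by [].
by apply: eq_forallb => y; rewrite !flipE (inj_eq (@addbI _)).
Qed.

Lemma idle_cnot z x y : z != x -> z != y -> idle z (gate_op (CNOT x y)).
Proof.
move=> zx zy; rewrite gate_op_CNOT; apply: idle_Mn => // b; first by rewrite cn_ne.
by apply/ffunP => w; rewrite !(cnE, flipE) (eq_sym x) (negbTE zx) /= addbCA.
Qed.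

Definition idle_off (S : {set site L}) A := forall z, z \notin S -> idle z A.

Lemma idle_gate g : idle_off (gate_support g) (gate_op g).
Proof.
case: g => [x U|x y] z /=; rewrite !inE; first exact: idle_onsite.
by rewrite negb_or => /andP[]; exact: idle_cnot.
Qed.

Definition addc a b : cfg L := [ffun z => a z (+) b z].

(** Induction on the number of flipped sites. It allows all spectator qubits to be reset at once. *)
Lemma idle_addc A (e : cfg L) : (forall z, e z -> idle z A) ->
  forall a b, ent A (addc a e) (addc b e) = ent A a b.
Proof.
have [n] := ubnP #|[set z | e z]|; elim: n e => // n IH e en eA a b.
case: (pickP (fun z => e z)) => [z ez|e0]; last first.
  by congr ent; apply/ffunP => z; rewrite ffunE e0 addbF.
have h (w : cfg L) : addc w e = flip (addc w (flip e z)) z.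
  by apply/ffunP => v; rewrite !(ffunE, flipE); case: eqP => [->|_]; case: (w _); case: (e _).
rewrite !h (eA _ ez).2 IH //; last first.
  by move=> v; rewrite flipE; case: eqP => [->|_] /=; [rewrite ez | exact: eA].
rewrite ltnS in en; apply: leq_trans en; rewrite [X in (_ < X)%N](cardsD1 z) inE ez add1n ltnS.
by apply/subset_leq_card/subsetP => v; rewrite !inE flipE; case: eqP => [->|]; rewrite ?ez.
Qed.

(** In either product only one intermediate configuration contributes, because [A] preserves the
    bits outside [S] and [B] those inside [S]. The entries that remain agree after flipping idle
    qubits. *)
Lemma idle_comm S T A B : idle_off S A -> idle_off T B -> [disjoint S & T] ->
  A *m B = B *m A.
Proof.
move=> hA hB dST; apply: ent_ext => a b.
have dz z : z \in S -> z \notin T by move=> zS; rewrite (disjointFr dST).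
pose c0 : cfg L := [ffun z => if z \in S then b z else a z].
pose c1 : cfg L := [ffun z => if z \in S then a z else b z].
have hAB : ent (A *m B) a b = ent A a c0 * ent B c0 b.
  rewrite ent_mul (bigD1 c0) //= big1 ?addr0 // => c; apply: contraNeq.
  rewrite mulf_eq0 negb_or => /andP[ha hb]; apply/eqP/ffunP => z; rewrite ffunE.
  case: ifPn => zS; apply/eqP.
    by apply: contraR hb => h; rewrite ((hB z (dz z zS)).1 _ _ h).
  by apply: contraR ha => h; rewrite ((hA z zS).1) // eq_sym.
have hBA : ent (B *m A) a b = ent B a c1 * ent A c1 b.
  rewrite ent_mul (bigD1 c1) //= big1 ?addr0 // => c; apply: contraNeq.
  rewrite mulf_eq0 negb_or => /andP[hb ha]; apply/eqP/ffunP => z; rewrite ffunE.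
  case: ifPn => zS; apply/eqP.
    by apply: contraR hb => h; rewrite ((hB z (dz z zS)).1) // eq_sym.
  by apply: contraR ha => h; rewrite ((hA z zS).1).
rewrite hAB hBA mulrC; congr (_ * _).
  pose e : cfg L := [ffun z => (z \in S) && (a z (+) b z)].
  rewrite -(@idle_addc B e); last by move=> z; rewrite ffunE => /andP[/dz h _]; exact: hB.
  congr ent; apply/ffunP => z; rewrite !ffunE; case: (z \in S) => /=; rewrite ?addbF //.
    by case: (a z); case: (b z).
  by case: (a z); case: (b z).
pose e : cfg L := [ffun z => (z \notin S) && (a z (+) b z)].
rewrite -(@idle_addc A e); last by move=> z; rewrite ffunE => /andP[h _]; exact: hA.
congr ent; apply/ffunP => z; rewrite !ffunE; case: (z \in S) => /=; rewrite ?addbF //;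
by case: (a z); case: (b z).
Qed.

Lemma idle_off_sub (S T : {set site L}) A : S \subset T -> idle_off S A -> idle_off T A.
Proof. by move=> /subsetP h hA z zT; apply: hA; apply: contra zT; apply: h. Qed.

Definition in_region (S : {set site L}) (c : circuit L) :=
  forall l, List.In l c -> forall g, List.In g l -> gate_support g \subset S.

Lemma idle_layer S (l : layer L) : (forall g, List.In g l -> gate_support g \subset S) ->
  idle_off S (layer_op l).
Proof.
elim: l => [|g l IH] h z zS /=; first exact: idle1.
apply: idleM; last by apply: IH => // g' g'l; apply: h; right.
by apply: idle_off_sub zS; [apply: h; left | apply: idle_gate].
Qed.

Lemma layer_op_cat (l1 l2 : layer L) : layer_op (l1 ++ l2) = layer_op l1 *m layer_op l2.
Proof. by elim: l1 => [|g l IH] /=; rewrite ?mul1mx // IH mulmxA. Qed.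

Lemma circuit_op_cons l (c : circuit L) : circuit_op (l :: c) = circuit_op c *m layer_op l.
Proof.
suff h (U : Op L) : foldl (fun acc l => layer_op l *m acc) U c = circuit_op c *m U.
  by rewrite /circuit_op /= mulmx1 h.
rewrite /circuit_op; elim: c U => [|l' c IH] U /=; first by rewrite mul1mx.
by rewrite IH [in RHS]IH mulmx1 mulmxA.
Qed.

Lemma circuit_op_cat (c1 c2 : circuit L) : circuit_op (c1 ++ c2) = circuit_op c2 *m circuit_op c1.
Proof.
elim: c1 => [|l c IH] /=; first by rewrite mulmx1.
by rewrite !circuit_op_cons IH mulmxA.
Qed.

Lemma idle_circuit S (c : circuit L) : in_region S c -> idle_off S (circuit_op c).
Proof.
elim: c => [|l c IH] h z zS; first exact: idle1.
rewrite circuit_op_cons; apply: idleM; first by apply: IH => // l' l'c; apply: h; right.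
by apply: idle_layer zS => g; apply: h; left.
Qed.

Fixpoint parc (c1 c2 : circuit L) : circuit L :=
  match c1, c2 with
  | [::], _ => c2
  | _, [::] => c1
  | l1 :: c1', l2 :: c2' => (l1 ++ l2) :: parc c1' c2'
  end.

Lemma parc_size (c1 c2 : circuit L) : size (parc c1 c2) = maxn (size c1) (size c2).
Proof. by elim: c1 c2 => [|l c IH] [|l2 c2] //=; rewrite ?max0n ?maxn0 // IH maxnSS. Qed.

Lemma parc_gates (c1 c2 : circuit L) : gate_count (parc c1 c2) = (gate_count c1 + gate_count c2)%N.
Proof.
rewrite /gate_count; elim: c1 c2 => [|l c IH] [|l2 c2] //=; first by rewrite addn0.
by rewrite IH size_cat addnACA.
Qed.

Lemma In_parc (c1 c2 : circuit L) l : List.In l (parc c1 c2) -> List.In l c1 \/ List.In l c2 \/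
  exists l1 l2, [/\ List.In l1 c1, List.In l2 c2 & l = l1 ++ l2].
Proof.
elim: c1 c2 => [|l1 c1 IH] [|l2 c2] //=; [by auto|by auto|].
case=> [<-|/IH]; first by right; right; exists l1, l2; split; auto.
case; [by auto|case; [by auto|]] => -[k1 [k2 [h1 h2 ->]]].
by right; right; exists k1, k2; split; auto.
Qed.

(** Merging layers moves each layer of [c2] past the remainder of [c1], which lives on a disjoint
    region. *)
Lemma parc_op S T (c1 c2 : circuit L) : in_region S c1 -> in_region T c2 -> [disjoint S & T] ->
  circuit_op (parc c1 c2) = circuit_op c2 *m circuit_op c1.
Proof.
move=> h1 h2 dST; elim: c1 c2 h1 h2 => [|l1 c1 IH] [|l2 c2] h1 h2 /=;
  rewrite ?mul1mx ?mulmx1 //.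
have hl1 : idle_off S (layer_op l1) by apply: idle_layer => g; apply: h1; left.
have hc2 : in_region T c2 by move=> l lc; apply: h2; right.
have hc1 : in_region S c1 by move=> l lc; apply: h1; right.
rewrite !circuit_op_cons IH // layer_op_cat.
have hl2 : idle_off T (layer_op l2) by apply: idle_layer => g; apply: h2; left.
rewrite -!mulmxA; congr (_ *m _).
by rewrite mulmxA -circuit_op_cons (idle_comm (idle_circuit h1) hl2 dST).
Qed.
End Idle.

(** * Circuits with bounds on region, gate count and depth *)

Section Impl.
Variable L : nat.
Implicit Types (A B U V : Op L) (b : cfg L) (x y z w : site L) (S T : {set site L}).

(** The circuit is hidden so that costs compose along operator identities; the region [S] is
    recorded because disjointness of regions is what permits parallel composition. *)
Definition impl S U (g d : nat) := exists c : circuit L,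
  [/\ circuit_ok c, in_region S c, circuit_op c = U,
      (gate_count c <= g)%N & (circuit_depth c <= d)%N].

Lemma impl_le S T U g d g' d' : impl S U g d -> S \subset T -> (g <= g')%N -> (d <= d')%N ->
  impl T U g' d'.
Proof.
move=> [c [h1 h2 h3 h4 h5]] ST gg dd; exists c; split=> //.
- by move=> l lc k kl; apply: subset_trans ST; apply: h2 lc _ kl.
- exact: leq_trans gg.
- exact: leq_trans dd.
Qed.

Lemma impl_id S : impl S 1%:M 0 0.
Proof. by exists [::]; split. Qed.

Lemma impl_gate S g : gate_valid g -> gate_support g \subset S -> impl S (gate_op g) 1 1.
Proof.
move=> gv gS; exists [:: [:: g]]; split=> //.
- by move=> l [<-|//]; split=> // g' [<-|//].
- by move=> l [<-|//] g' [<-|//].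
- by rewrite circuit_op_cons /= mulmx1 mul1mx.
Qed.

Lemma impl_seq S U V g d g' d' : impl S U g d -> impl S V g' d' ->
  impl S (V *m U) (g + g') (d + d').
Proof.
move=> [c [h1 h2 h3 h4 h5]] [c' [h1' h2' h3' h4' h5']]; exists (c ++ c'); split.
- by move=> l /List.in_app_iff[/h1|/h1'].
- by move=> l /List.in_app_iff[/h2|/h2'].
- by rewrite circuit_op_cat h3 h3'.
- by rewrite /gate_count map_cat sumn_cat leq_add.
- by rewrite /circuit_depth size_cat leq_add.
Qed.

Lemma pairwise_In (r : rel (gate L)) (l1 l2 : layer L) :
  (forall g h, List.In g l1 -> List.In h l2 -> r g h) -> allrel r l1 l2.
Proof.
move=> h; rewrite /allrel; elim: l1 h => //= g l1 IH h; rewrite IH ?andbT; last first.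
  by move=> g' k g'l kl; apply: h; auto.
have {}h k : List.In k l2 -> r g k by move=> kl; apply: h; auto.
by elim: l2 h {IH} => //= k l2 IH h; rewrite h ?IH //; auto => k' k'l; apply: h; auto.
Qed.

Lemma impl_par S T U V g d g' d' : impl S U g d -> impl T V g' d' -> [disjoint S & T] ->
  impl (S :|: T) (V *m U) (g + g') (maxn d d').
Proof.
move=> [c [h1 h2 h3 h4 h5]] [c' [h1' h2' h3' h4' h5']] dST; exists (parc c c'); split.
- move=> l /In_parc [/h1//|[/h1'//|[l1 [l2 [i1 i2 ->]]]]]; split.
    by move=> k /List.in_app_iff[]; [apply: (h1 _ i1).1|apply: (h1' _ i2).1].
  rewrite pairwise_cat (h1 _ i1).2 (h1' _ i2).2 !andbT; apply: pairwise_In => k k' kl kl'.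
  by apply: disjointWl (h2 _ i1 _ kl) _; apply: disjointWr (h2' _ i2 _ kl') _.
- move=> l /In_parc [lc|[lc|[l1 [l2 [i1 i2 ->]]]]] k kl.
  + by apply: subset_trans (subsetUl _ _); apply: h2 lc _ kl.
  + by apply: subset_trans (subsetUr _ _); apply: h2' lc _ kl.
  + case/List.in_app_iff: kl => kl.
      by apply: subset_trans (subsetUl _ _); apply: h2 i1 _ kl.
    by apply: subset_trans (subsetUr _ _); apply: h2' i2 _ kl.
- by rewrite (parc_op h2 h2' dST) h3 h3'.
- by rewrite parc_gates leq_add.
- by rewrite /circuit_depth parc_size geq_max !leq_max h5 h5' orbT.
Qed.

(** The convention of [ordered_prod], to which it unfolds for lists of pairs: later entries act
    later, on the left. *)
Definition oprod (T : Type) (U : T -> Op L) (r : seq T) : Op L :=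
  foldl (fun acc i => U i *m acc) 1%:M r.

Lemma oprod_cons (T : Type) (U : T -> Op L) i r : oprod U (i :: r) = oprod U r *m U i.
Proof.
rewrite /oprod /= mulmx1; elim: r (U i) => [|j r IH] V /=; first by rewrite mul1mx.
by rewrite IH [in RHS]IH mulmx1 mulmxA.
Qed.

Lemma oprod_cat (T : Type) (U : T -> Op L) r s : oprod U (r ++ s) = oprod U s *m oprod U r.
Proof.
elim: r => [|i r IH] /=; first by rewrite mulmx1.
by rewrite !oprod_cons IH mulmxA.
Qed.

Lemma oprod_flatten (T I : Type) (U : T -> Op L) (r : I -> seq T) s :
  oprod U (flatten [seq r i | i <- s]) = oprod (fun i => oprod U (r i)) s.
Proof. by elim: s => //= i s IH; rewrite oprod_cat oprod_cons IH. Qed.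

Lemma oprod_Dg (T : Type) (q : T -> cfg L -> bool) r :
  oprod (fun i => Dg (q i)) r = Dg (fun b => \xor_(i <- r) q i b).
Proof.
elim: r => [|i r IH].
  by rewrite -[oprod _ _]Dg0; apply: eq_Dg => b; rewrite big_nil.
by rewrite oprod_cons IH DgM; apply: eq_Dg => b; rewrite big_cons addbC.
Qed.

(** Adjacent factors [B *m A] telescope; this is why a stage needs its reordering sign only at its
    two ends. *)
Lemma oprod_conj (T : Type) (U : T -> Op L) r A B : A *m B = 1%:M -> B *m A = 1%:M ->
  oprod (fun i => A *m U i *m B) r = A *m oprod U r *m B.
Proof.
move=> AB BA; elim: r => [|i r IH]; first by rewrite /oprod /= mulmx1 AB.
by rewrite !oprod_cons IH !mulmxA -(mulmxA _ B A) BA mulmx1.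
Qed.

Lemma impl_seq_big (I : eqType) S (U : I -> Op L) (r : seq I) g d :
  (forall i, i \in r -> impl S (U i) g d) ->
  impl S (oprod U r) (size r * g) (size r * d).
Proof.
elim: r => [|i r IH] h; first exact: impl_id.
rewrite oprod_cons /= !mulSn; apply: impl_seq; first by apply: h; rewrite inE eqxx.
by apply: IH => j jr; apply: h; rewrite inE jr orbT.
Qed.

(** The regions are fibres of one labelling [f], so distinct labels are disjoint by construction and
    the depth does not accumulate. *)
Lemma impl_par_big (I : eqType) (f : site L -> I) (U : I -> Op L) (r : seq I) g d :
  uniq r -> (forall i, i \in r -> impl [set z | f z == i] (U i) g d) ->
  impl [set z | f z \in r] (oprod U r) (size r * g) d.
Proof.
elim: r => [|i r IH] /= ur h; first by apply: impl_le (impl_id set0) (sub0set _) _ _.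
case/andP: ur => ir ur.
rewrite oprod_cons /= mulSn.
have h1 := h i (mem_head _ _).
have h2 : impl [set z | f z \in r] (oprod U r) (size r * g) d.
  by apply: IH => // j jr; apply: h; rewrite inE jr orbT.
apply: impl_le (impl_par h1 h2 _) _ _ _; rewrite ?maxnn //.
  rewrite disjoints_subset; apply/subsetP => z; rewrite !inE => /eqP->//.
by apply/subsetP => z; rewrite !inE.
Qed.

Lemma impl_conj S U V W g d g' d' : impl S U g d -> impl S W g d -> impl S V g' d' ->
  impl S (W *m V *m U) (g.*2 + g') (d.*2 + d').
Proof.
move=> hU hW hV; rewrite -mulmxA.
by apply: impl_le (impl_seq (impl_seq hU hV) hW) (subxx _) _ _; lia.
Qed.

End Impl.
(** * Long-range CNOT and controlled phases *)

Section LongRange.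
Variable L : nat.
Implicit Types (A B U V : Op L) (b : cfg L) (x y z w : site L) (S T : {set site L}).

Definition mid (p q r : nat) : bool := (p <= r <= q)%N || (q <= r <= p)%N.
(** Routing region of a long-range CNOT. It stays inside any coordinatewise convex set containing
    both ends, in particular inside a block, a column of blocks or a slab. *)
Definition box x y : {set site L} :=
  [set z : site L | [&& mid x.1.1 y.1.1 z.1.1, mid x.1.2 y.1.2 z.1.2 & mid x.2 y.2 z.2]].

Lemma mem_box_l x y : x \in box x y.
Proof. by rewrite inE /mid !leqnn /=; lia. Qed.

Lemma mem_box_r x y : y \in box x y.
Proof. by rewrite inE /mid !leqnn /=; lia. Qed.

Lemma coord_step (p q : 'I_L) : p != q -> exists r : 'I_L,
  [/\ absd p r = 1%N, absd p q = (absd r q).+1 & forall s, mid r q s -> mid p q s].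
Proof.
rewrite -val_eqE /= => pq; have [hp hq] := (ltn_ord p, ltn_ord q).
case: (ltnP p q) => lt.
  have h : (p.+1 < L)%N by lia.
  by exists (Ordinal h); split; rewrite /absd /mid /=; lia.
have h : (p.-1 < L)%N by lia.
by exists (Ordinal h); split; rewrite /absd /mid /=; lia.
Qed.

Lemma path_step x y : x != y -> exists w,
  [/\ l1 x w = 1%N, l1 x y = (l1 w y).+1, w \in box x y & box w y \subset box x y].
Proof.
have ad0 p : absd p p = 0%N by rewrite /absd; lia.
case: x y => [[x1 x2] x3] [[y1 y2] y3]; rewrite !xpair_eqE !negb_and => /orP[/orP[]|] ne;
 have [r [h1 h2 h3]] := coord_step ne.
- exists (r, x2, x3); rewrite /l1 /=; split; rewrite ?ad0 ?h1 ?h2 //.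
    by rewrite inE /= h3 /mid ?leqnn; lia.
  by apply/subsetP => z; rewrite !inE /= => /andP[/h3->].
- exists (x1, r, x3); rewrite /l1 /=; split; rewrite ?ad0 ?h1 ?h2; [lia|lia| |].
    by rewrite inE /= h3 /mid ?leqnn; lia.
  by apply/subsetP => z; rewrite !inE /= => /and3P[-> /h3->].
- exists (x1, x2, r); rewrite /l1 /=; split; rewrite ?ad0 ?h1 ?h2; [lia|lia| |].
    by rewrite inE /= h3 /mid ?leqnn; lia.
  by apply/subsetP => z; rewrite !inE /= => /and3P[-> -> /h3->].
Qed.

Lemma l1_eq0 x y : (l1 x y == 0)%N = (x == y).
Proof.
case: x y => [[x1 x2] x3] [[y1 y2] y3]; rewrite !xpair_eqE -!val_eqE /l1 /absd /=; lia.
Qed.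

(* A CNOT over distance n+1 is the group commutator of a neighbouring CNOT and
   a CNOT over distance n. *)
Lemma impl_cnot n x y : x != y -> (l1 x y <= n)%N -> impl (box x y) (Pm (cn x y)) (4 ^ n) (4 ^ n).
Proof.
elim: n x y => [|n IH] x y xy; first by rewrite leqn0 l1_eq0 (negbTE xy).
have [w [xw e wb sb]] := path_step xy; rewrite e ltnS => ln.
have [n0 n1] : (0 < 4 ^ n)%N /\ (4 ^ n.+1 = 4 * 4 ^ n)%N by rewrite expnS expn_gt0.
case: (eqVneq w y) => [ewy|wy].
  rewrite -gate_op_CNOT -ewy; apply: impl_le (impl_gate _ _) (subxx _) _ _; [exact: xw| |lia|lia].
  by rewrite /= subUset !sub1set mem_box_l mem_box_r.
have nxw : x != w by rewrite -l1_eq0 xw.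
have h1 : impl (box x y) (Pm (cn x w)) 1 1.
  rewrite -gate_op_CNOT; apply: impl_gate => //=.
  by rewrite subUset !sub1set mem_box_l wb.
have h2 : impl (box x y) (Pm (cn w y)) (4 ^ n) (4 ^ n) by apply: impl_le (IH w y wy ln) sb _ _.
have n4 : (0 < n)%N by apply: leq_trans ln; rewrite lt0n l1_eq0.
have n5 : (4 <= 4 ^ n)%N by rewrite -(prednK n4) expnS; have := expn_gt0 4 n.-1; lia.
have -> : Pm (cn x y) = Pm (cn w y) *m Pm (cn x w) *m (Pm (cn w y) *m Pm (cn x w)).
  rewrite !PmM; apply: eq_Mn => // b; apply/ffunP => z; rewrite !cnE.
  rewrite (negbTE nxw) (negbTE wy) (negbTE xy) eqxx /=.
  case: (eqVneq z w) => [->|zw]; case: (eqVneq z y) => [zy|zy] //=;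
   rewrite ?(negbTE wy) ?(negbTE xy) ?zy ?eqxx /=; rewrite ?(negbTE wy) /=; by case: (b x); case: (b w); case: (b z); case: (b y).
(* Two recursive circuits and two neighbouring gates cost [2 * 4 ^ n + 2], which is at most
   [4 ^ n.+1]. *)
have h3 := impl_seq (impl_seq h1 h2) (impl_seq h1 h2).
by apply: (impl_le h3) => //; lia.
Qed.

Definition unit_ph (p : C) := p * p^* = 1.

Lemma unit_phE p : unit_ph p <-> `|p| = 1.
Proof.
rewrite /unit_ph -normCK; split=> [h|->]; last by rewrite expr1n.
by apply/eqP; rewrite -(@pexpr_eq1 _ _ 2) // h.
Qed.

Definition diag2 (p0 p1 : C) : 'M[C]_2 := \matrix_(i, j) if i == j then (if i == 0 then p0 else p1) else 0.

Lemma bit0 (b : bool) : (bit b == 0) = ~~ b.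
Proof. by rewrite -val_eqE /= inordK; case: b. Qed.

Lemma bit_inj : injective bit.
Proof. by move=> p q e; apply: negb_inj; rewrite -!bit0 e. Qed.

Lemma diag2_bit p0 p1 (a b : bool) : diag2 p0 p1 (bit a) (bit b) =
  if a == b then (if a then p1 else p0) else 0.
Proof. by rewrite mxE (inj_eq bit_inj) bit0; case: a; case: b. Qed.

Lemma onsite_diag x p0 p1 : onsite x (diag2 p0 p1) = Dp (fun b => if b x then p1 else p0).
Proof.
apply: ent_ext => a b; rewrite onsite_ent ent_Mn diag2_bit.
case: (eqVneq a b) => [->|ab]; first by rewrite eqxx; case: forallP => // -[] y; rewrite eqxx implybT.
case: forallP => // h; case: eqP => // e; case/eqP: ab; apply/ffunP => y.
by case: (eqVneq y x) => [->//|yx]; have := h y; rewrite yx => /eqP.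
Qed.

Lemma diag2_unitary p0 p1 : unit_ph p0 -> unit_ph p1 -> Defs.is_unitary (diag2 p0 p1).
Proof.
move=> h0 h1; have h (p : C) : unit_ph p -> p^* * p = 1 by rewrite mulrC.
by split; apply/matrixP => -[[|[|//]] hi] -[[|[|//]] hj];
  rewrite !mxE !big_ord_recl big_ord0 !mxE /= ?rmorph0 ?mulr0 ?mul0r ?addr0 ?add0r ?h0 ?h1 ?h.
Qed.

Lemma impl_phase S x p0 p1 : x \in S -> unit_ph p0 -> unit_ph p1 ->
  impl S (Dp (fun b => if b x then p1 else p0)) 1 1.
Proof.
move=> xS h0 h1; rewrite -onsite_diag; apply: (impl_gate (g := Gate1 x (diag2 p0 p1))).
  exact: diag2_unitary.
by rewrite sub1set.
Qed.

(** Two long-range CNOTs and three single-site phases. *)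
Definition cz_cost n := (2 * 4 ^ n + 3)%N.

(* With r^2 = e0/e1 the phase is r^(x+y) times single-site phases, because
   2 x y = x + y - (x xor y). *)
Lemma impl_cphase n S x y e0 e1 : x != y -> (l1 x y <= n)%N -> box x y \subset S ->
  unit_ph e0 -> unit_ph e1 ->
  impl S (Dp (fun b => if b y then (if b x then e1 else e0) else 1)) (cz_cost n) (cz_cost n).
Proof.
move=> xy ln bS /unit_phE h0 /unit_phE h1.
pose r := sqrtC (e0 / e1).
have hr : `|r| = 1.
  by apply/eqP; rewrite -(@pexpr_eq1 _ _ 2) // -normrX sqrtCK normf_div h0 h1 divr1.
have nz (p : C) : `|p| = 1 -> p != 0 by rewrite -normr_eq0 => ->; rewrite oner_eq0.
have [r0 e10] := (nz _ hr, nz _ h1).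
have er : r * r = e0 / e1 by rewrite -expr2 sqrtCK.
have xS : x \in S by apply: (subsetP bS); apply: mem_box_l.
have yS : y \in S by apply: (subsetP bS); apply: mem_box_r.
have hc : impl S (Pm (cn x y)) (4 ^ n) (4 ^ n) by apply: impl_le (impl_cnot xy ln) bS _ _.
have u1 : unit_ph 1 by apply/unit_phE; rewrite normr1.
have f1 : impl S (Dp (fun b => if b x then r^-1 else 1)) 1 1.
  by apply: impl_phase => //; apply/unit_phE; rewrite normfV hr invr1.
have f2 : impl S (Dp (fun b => if b y then e0 / r else 1)) 1 1.
  by apply: impl_phase => //; apply/unit_phE; rewrite normf_div hr h0 divr1.
have f3 : impl S (Dp (fun b => if b y then r else 1)) 1 1.
  by apply: impl_phase => //; apply/unit_phE.
have := impl_seq f1 (impl_seq f2 (impl_conj hc hc f3)).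
rewrite Pm_conj; last exact: (inv_inj (cnK xy)) || exact: cnK.
rewrite !DpM => hh; move: hh.
set D := Dp _; set D' := Dp _; suff -> : D = D'.
  by move=> k; apply: impl_le k (subxx _) _ _; rewrite /cz_cost; lia.
apply: eq_Dp => b; rewrite cn_eq; case: (b x); case: (b y) => /=; rewrite ?mulr1 ?mul1r.
- by rewrite -mulrA -invfM er invf_div mulrCA mulfV ?nz // mulr1.
- by rewrite mulfV.
- by rewrite mulrCA mulfV // mulr1.
- by [].
Qed.

Lemma impl_cz n S x y : x != y -> (l1 x y <= n)%N -> box x y \subset S ->
  impl S (Dg (fun b => b x && b y)) (cz_cost n) (cz_cost n).
Proof.
move=> xy ln bS; have u1 : unit_ph 1 by apply/unit_phE; rewrite normr1.
have u2 : unit_ph (-1) by apply/unit_phE; rewrite normrN1.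
have := impl_cphase xy ln bS u1 u2.
by set D := Dp _; set D' := Dg _; suff -> : D = D' by []; apply: eq_Dp => b; case: (b x); case: (b y).
Qed.
End LongRange.
(** * Two-qubit unitaries *)

Section TwoSite.
Variable L : nat.
Implicit Types (A B : 'M[C]_2) (M N : Op L) (a b c : cfg L) (x y z w : site L) (S T : {set site L}).

Definition eqoff x a b := [forall z, (z != x) ==> (a z == b z)].
Definition setx b x v : cfg L := [ffun z => if z == x then v else b z].

Lemma eqoffP x a b : reflect (forall z, z != x -> a z = b z) (eqoff x a b).
Proof.
apply: (iffP forallP) => h z; first by move=> zx; have := h z; rewrite zx => /eqP.
by apply/implyP => /h/eqP.
Qed.

Lemma eqoffC x a b : eqoff x a b = eqoff x b a.
Proof. by apply: eq_forallb => z; rewrite (eq_sym (a z)). Qed.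

Lemma sum_eqoff x b (F : cfg L -> C) : (forall c, ~~ eqoff x c b -> F c = 0) ->
  \sum_c F c = F (setx b x false) + F (setx b x true).
Proof.
move=> h; have ne : setx b x true != setx b x false.
  by apply/eqP => /ffunP /(_ x); rewrite !ffunE eqxx.
rewrite (bigD1 (setx b x false)) //= (bigD1 (setx b x true)) //= big1 ?addr0 //.
move=> c /andP[c0 c1]; apply: h; apply: contraNN c0 => /eqoffP e.
case cx: (c x); last by apply/eqP/ffunP => z; rewrite ffunE; case: eqP => [->|/eqP/e].
by case/eqP: c1; apply/ffunP => z; rewrite ffunE; case: eqP => [->|/eqP/e].
Qed.

Lemma sum_bit (F : 'I_2 -> C) : \sum_i F i = F (bit false) + F (bit true).
Proof.
rewrite !big_ord_recl big_ord0 addr0; congr (F _ + F _); apply/val_inj => /=;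
by rewrite inordK.
Qed.

Lemma bit_surj (i : 'I_2) : exists v, i = bit v.
Proof.
case: i => [[|[|//]] hi]; [exists false|exists true]; apply/val_inj => /=; by rewrite inordK.
Qed.

(* The multiplexed single-qubit gate: [A0] or [A1] on [x] according to [y]. *)
Definition Ct x y (A0 A1 : 'M[C]_2) : Op L := mxOf (fun a b =>
  if eqoff x a b then (if b y then A1 else A0) (bit (a x)) (bit (b x)) else 0).

Lemma CtM x y A0 A1 B0 B1 : x != y ->
  Ct x y A0 A1 *m Ct x y B0 B1 = Ct x y (A0 *m B0) (A1 *m B1).
Proof.
move=> xy; apply: ent_ext => a b; rewrite ent_mul !ent_mxOf.
rewrite (sum_eqoff (x := x) (b := b)); last first.
  by move=> c /negbTE h; rewrite !ent_mxOf h mulr0.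
rewrite !ent_mxOf.
have e v : eqoff x (setx b x v) b by apply/eqoffP => z /negbTE zx; rewrite ffunE zx.
have e' v : eqoff x a (setx b x v) = eqoff x a b.
  by apply: eq_forallb => z; rewrite ffunE; case: eqP.
rewrite !e !e' !ffunE eqxx eq_sym (negbTE xy).
case: ifP => _; last by rewrite !mul0r addr0.
by case: (b y); rewrite !mxE sum_bit.
Qed.

Lemma onsite_Ct x y U0 : onsite x U0 = Ct x y U0 U0.
Proof. by apply: ent_ext => a b; rewrite !ent_mxOf; case: (b y). Qed.

Lemma Ct_diag x y e0 e1 :
  Ct x y 1%:M (diag2 e0 e1) = Dp (fun b => if b y then (if b x then e1 else e0) else 1).
Proof.
apply: ent_ext => a b; rewrite ent_mxOf ent_Mn.
have [e|ne] := boolP (eqoff x a b); last first.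
  by case: eqP => // e; case/eqoffP: ne => z _; rewrite e.
have -> : (a == b) = (a x == b x).
  apply/eqP/eqP => [->//|h]; apply/ffunP => z; case: (eqVneq z x) => [->//|].
  exact: (eqoffP _ _ _ e).
case: (b y); first by rewrite diag2_bit; case: eqP => // ->.
by rewrite mxE (inj_eq bit_inj); case: eqP.
Qed.

Lemma Ct1 x y : Ct x y 1%:M 1%:M = 1%:M.
Proof.
have -> : (1%:M : 'M[C]_2) = diag2 1 1 by apply/matrixP => i j; rewrite !mxE; case: eqP => //; case: ifP.
have -> : Ct x y (diag2 1 1) (diag2 1 1) = Ct x y 1%:M (diag2 1 1).
  by congr Ct; apply/matrixP => i j; rewrite !mxE; case: eqP => //; case: ifP.
by rewrite Ct_diag -Mn1; apply: eq_Dp => b; case: (b y); case: (b x).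
Qed.

Lemma adj_Ct x y A0 A1 : x != y -> adj (Ct x y A0 A1) = Ct x y (adj A0) (adj A1).
Proof.
move=> xy; apply: ent_ext => a b; rewrite ent_adj !ent_mxOf eqoffC.
case: ifP => [/eqoffP e|]; last by rewrite rmorph0.
by rewrite e 1?eq_sym //; case: (b y); rewrite !mxE.
Qed.

(** The two blocks are read off from entries whose spectator qubits are all zero. It serves to pass
    from unitarity of a multiplexed gate to unitarity of its blocks. *)
Lemma Ct_inj x y A0 A1 B0 B1 : x != y -> Ct x y A0 A1 = Ct x y B0 B1 -> A0 = B0 /\ A1 = B1.
Proof.
move=> xy e; pose k (w v : bool) := setx (setx (allzero L) y w) x v.
have kx (w v : bool) : k w v x = v by rewrite ffunE eqxx.
have ky (w v : bool) : k w v y = w by rewrite !ffunE eq_sym (negbTE xy) eqxx.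
have kk (w v v' : bool) : eqoff x (k w v) (k w v') by apply/eqoffP => z /negbTE zx; rewrite !ffunE zx.
split; apply/matrixP => i j; have [v ->] := bit_surj i; have [v' ->] := bit_surj j.
  have := congr1 (fun A : Op L => ent A (k false v) (k false v')) e.
  by rewrite !ent_mxOf !kx !ky !kk.
have := congr1 (fun A : Op L => ent A (k true v) (k true v')) e.
by rewrite !ent_mxOf !kx !ky !kk.
Qed.

Lemma unitaryM n (A B : 'M[C]_n) : Defs.is_unitary A -> Defs.is_unitary B -> Defs.is_unitary (A *m B).
Proof.
have am : adj (A *m B) = adj B *m adj A by rewrite /adj map_mxM trmx_mul.
move=> [A1 A2] [B1 B2]; split; rewrite am !mulmxA.
  by rewrite -(mulmxA A) B1 mulmx1.
by rewrite -(mulmxA _ (adj A)) A2 mulmx1.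
Qed.

Lemma unitary_adj n (A : 'M[C]_n) : Defs.is_unitary A -> Defs.is_unitary (adj A).
Proof.
have aK : adj (adj A) = A by apply/matrixP => i j; rewrite !mxE conjCK.
by move=> [A1 A2]; split; rewrite aK.
Qed.

Lemma adj_tC n (A : 'M[C]_n) : adj A = map_mx Num.conj (A^T).
Proof. by rewrite /adj map_trmx. Qed.

(** A unitary is normal, hence unitarily diagonalisable; the eigenvalues have modulus one because
    the diagonal form is again unitary. *)
Lemma unitary_spectral n (U : 'M[C]_n) : Defs.is_unitary U ->
  exists P (d : 'rV[C]_n), [/\ Defs.is_unitary P, U = adj P *m diag_mx d *m P &
    forall i, unit_ph (d 0 i)].
Proof.
move=> [U1 U2].
have nU : U \is normalmx by apply/normalmxP; rewrite -!adj_tC U1 U2.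
have eU := orthomx_spectralP nU.
set P := spectralmx U in eU; set d := spectral_diag U in eU.
have uP := spectral_unitarymx U.
have P1 : P *m adj P = 1%:M by rewrite adj_tC; exact/unitarymxP.
have P2 : adj P *m P = 1%:M by apply: mulmx1C.
rewrite (invmx_unitary uP) -adj_tC in eU.
exists P, d; split=> // i.
have eD : diag_mx d = P *m U *m adj P.
  by rewrite {1}eU !mulmxA P1 mul1mx -mulmxA P1 mulmx1.
have hD : diag_mx d *m adj (diag_mx d) = 1%:M.
  by have [] : Defs.is_unitary (diag_mx d) by rewrite eD; apply: unitaryM; [apply: unitaryM|apply: unitary_adj].
have := congr1 (fun A : 'M[C]_n => A i i) hD.
by rewrite mul_diag_mx !mxE eqxx !mulr1n.
Qed.

(** Diagonalising [adj A0 *m A1] as [adj P *m diag_mx d *m P] turns the multiplexed gate into one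
    controlled phase between the single-qubit gates [P] and [A0 *m adj P]. *)
Lemma impl_Ct n S x y A0 A1 : x != y -> (l1 x y <= n)%N -> box x y \subset S ->
  Defs.is_unitary A0 -> Defs.is_unitary A1 ->
  impl S (Ct x y A0 A1) (cz_cost n + 2) (cz_cost n + 2).
Proof.
move=> xy ln bS u0 u1.
have xS : x \in S by apply: (subsetP bS); apply: mem_box_l.
have [P [d [uP eU hd]]] := unitary_spectral (unitaryM (unitary_adj u0) u1).
have eA1 : A1 = A0 *m adj P *m diag_mx d *m P by rewrite -!mulmxA (mulmxA (adj P)) -eU mulmxA u0.1 mul1mx.
have ed : diag_mx d = diag2 (d 0 0) (d 0 (bit true)).
  apply/matrixP => i j; have [v ->] := bit_surj i; have [v' ->] := bit_surj j.
  rewrite diag2_bit mxE (inj_eq bit_inj) mulrb; case: eqP => // _; case: v => //.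
  by congr (d _ _); apply/eqP; rewrite bit0.
have -> : Ct x y A0 A1 = onsite x (A0 *m adj P) *m Dp (fun b => if b y then (if b x then d 0 (bit true) else d 0 0) else 1) *m onsite x P.
  by rewrite -Ct_diag !(onsite_Ct _ y) !CtM // -ed mulmx1 -mulmxA uP.2 mulmx1 -eA1.
have g U0 : Defs.is_unitary U0 -> impl S (onsite x U0) 1 1.
  by move=> uU; apply: (impl_gate (g := Gate1 x U0)) => //; rewrite sub1set.
rewrite -mulmxA; have h := impl_seq (impl_seq (g _ uP) (impl_cphase xy ln bS (hd 0) (hd (bit true)))) (g _ (unitaryM u0 (unitary_adj uP))).
by apply: (impl_le h) => //; lia.
Qed.

(** Conjugation by the CNOT from [x] to [y] stores the parity of the pair in [y]. Since [M]
    preserves this parity, the conjugated operator is a single-qubit gate on [x] selected by [y]. *)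
Lemma impl_two_site n S x y M : x != y -> (l1 x y <= n)%N -> box x y \subset S ->
  Defs.is_unitary M -> (forall z, z != x -> z != y -> idle z M) ->
  (forall a b, a x (+) a y != b x (+) b y -> ent M a b = 0) ->
  impl S M (2 * 4 ^ n + cz_cost n + 2) (2 * 4 ^ n + cz_cost n + 2).
Proof.
move=> xy ln bS uM iM pM.
pose Q := Pm (cn x y); pose N := Q *m M *m Q.
have QQ : Q *m Q = 1%:M by rewrite PmM -Mn1; apply: eq_Mn => // b; rewrite cnK.
have eN a b : ent N a b = ent M (cn x y a) (cn x y b).
  by rewrite ent_mulMn mulr1 (ent_Mnmul (g := cn x y)) ?mul1r //; exact: cnK.
have iN z : z != x -> z != y -> idle z N.
  move=> zx zy; have iQ : idle z Q by rewrite /Q -gate_op_CNOT; exact: idle_cnot.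
  by apply: idleM => //; apply: idleM => //; apply: iM.
have N0 a b : ~~ eqoff x a b -> ent N a b = 0.
  case/forallPn => z; rewrite negb_imply => /andP[zx abz].
  case: (eqVneq z y) => [e|zy]; last exact: (iN z zx zy).1.
  rewrite eN pM // !cn_eq !cn_ne // !addbA !addbb -e //.
pose k (w v : bool) := setx (setx (allzero L) y w) x v.
pose A (w : bool) : 'M[C]_2 := \matrix_(i, j) ent N (k w (i != 0)) (k w (j != 0)).
have eNC : N = Ct x y (A false) (A true).
  apply: ent_ext => a b; rewrite [RHS]ent_mxOf; case: ifP => [/eqoffP e|/negbT/N0//].
  have -> : (if b y then A true else A false) = A (b y) by case: (b y).
  rewrite mxE !bit0 !negbK.
  (* Adding [f] clears every qubit of [b] other than [x] and [y], which does not change the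
     entry. *)
  pose f : cfg L := [ffun z => [&& z != x, z != y & b z]].
  rewrite -(@idle_addc _ N f); last by move=> z; rewrite ffunE => /and3P[zx zy _]; exact: iN.
  congr ent; apply/ffunP => z; rewrite !ffunE; case: (eqVneq z x) => [->|zx] /=; rewrite ?addbF //;
  case: (eqVneq z y) => [->|zy] /=; rewrite ?addbF ?addbb // ?e ?addbb //.
  by rewrite eq_sym.
have adjQ : adj Q = Q.
  apply: ent_ext => a b; rewrite ent_adj !ent_Mn.
  have -> : (a == cn x y b) = (b == cn x y a).
    by apply/eqP/eqP => ->; rewrite cnK.
  by case: eqP; rewrite ?rmorph1 ?rmorph0.
have uN : Defs.is_unitary N.
  have uQ : Defs.is_unitary Q by split; rewrite adjQ.
  by apply: unitaryM => //; apply: unitaryM.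
have uA : Defs.is_unitary (A false) /\ Defs.is_unitary (A true).
  move: uN; rewrite eNC /Defs.is_unitary adj_Ct // !CtM // -!(Ct1 x y) => -[].
  by move=> /(Ct_inj xy)[? ?] /(Ct_inj xy)[? ?].
have -> : M = Q *m N *m Q by rewrite /N !mulmxA QQ mul1mx -mulmxA QQ mulmx1.
have hc : impl S Q (4 ^ n) (4 ^ n) by apply: impl_le (impl_cnot xy ln) bS _ _.
rewrite eNC; have h := impl_conj hc hc (impl_Ct xy ln bS uA.1 uA.2).
by apply: (impl_le h) => //; lia.
Qed.
End TwoSite.

(** * Removal of the Jordan-Wigner string of a pair *)

Lemma xor_delta (I : eqType) (r : seq I) (F : I -> bool) i : uniq r ->
  \xor_(j <- r) ((j == i) && F j) = (i \in r) && F i.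
Proof.
elim: r => [|j r IH] /=; first by rewrite big_nil.
case/andP=> jr ur; rewrite big_cons IH // inE (eq_sym i).
by case: eqP => [e|//]; rewrite -e (negbTE jr) /= addbF.
Qed.

Lemma xor_andr (I : Type) (r : seq I) (P : pred I) (F : I -> bool) c :
  \xor_(i <- r | P i) (c && F i) = c && \xor_(i <- r | P i) F i.
Proof. by case: c => //=; rewrite big1. Qed.

Section Twisted.
Variable L : nat.
Implicit Types (E : Op L) (a b c : cfg L) (x y z w : site L) (S T : {set site L}).

(** At most [s] controlled signs on each side of a two-site gate. *)
Definition pair_cost s n := (2 * (s * cz_cost n) + (2 * 4 ^ n + cz_cost n + 2))%N.

(* [tau] records the sites of the Jordan-Wigner string of the pair [x, y]; the
   string is removed by the gates CZ(x, z), z in the string. *)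
Lemma impl_twisted n S x y E (tau : site L -> bool) : x != y -> x \in S -> y \in S ->
  (forall u v, u \in S -> v \in S -> box u v \subset S /\ (l1 u v <= n)%N) ->
  Defs.is_unitary E ->
  (forall z a b, z != x -> z != y -> a z != b z -> ent E a b = 0) ->
  (forall a b, a x (+) a y != b x (+) b y -> ent E a b = 0) ->
  (forall z a b, z != x -> z != y ->
     ent E (flip a z) (flip b z) = sgn ((a x (+) b x) && tau z) * ent E a b) ->
  (forall z, z \notin S -> tau z = false) ->
  impl S E (pair_cost #|S| n) (pair_cost #|S| n).
Proof.
move=> xy xS yS hS uE E0 Ep Et t0.
pose r := [seq z <- enum S | [&& z != x, z != y & tau z]].
have ur : uniq r by rewrite filter_uniq ?enum_uniq.
pose q b := \xor_(z <- r) (b x && b z).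
have memr z : z != x -> z != y -> (z \in r) = tau z.
  move=> zx zy; rewrite mem_filter mem_enum zx zy /=.
  by case: (boolP (z \in S)) => [|/t0->]; rewrite ?andbT.
have hD : impl S (Dg q) (#|S| * cz_cost n) (#|S| * cz_cost n).
  rewrite -oprod_Dg.
  have h : impl S (oprod (fun z => Dg (fun b : cfg L => b x && b z)) r)
                (size r * cz_cost n) (size r * cz_cost n).
    apply: impl_seq_big => z; rewrite mem_filter mem_enum => /andP[/andP[zx _] zS].
    by have [h1 h2] := hS x z xS zS; apply: impl_cz => //; rewrite eq_sym.
  have le : (size r <= #|S|)%N by rewrite cardE size_filter count_size.
  by apply: (impl_le h) => //; rewrite leq_mul2r le orbT.
pose M := Dg q *m E *m Dg q.
have eM a b : ent M a b = sgn (q a) * ent E a b * sgn (q b) by rewrite ent_Dp_r ent_Dp_l.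
have q_flip b z : z != x -> z != y -> q (flip b z) = q b (+) (b x && tau z).
  move=> zx zy; rewrite /q -(memr z) // !xor_andr flip_ne 1?eq_sym // -andb_addr; congr (_ && _).
  rewrite -[z \in r]andbT -(@xor_delta _ r (fun=> true)) // -big_split /=.
  by apply: eq_bigr => w _; rewrite flipE andbT addbC.
have uD : Defs.is_unitary (Dg q) by split; rewrite adj_Dg DgK.
have uM : Defs.is_unitary M by apply: unitaryM => //; apply: unitaryM.
(* Flipping [z] multiplies the two outer signs by those of [a x && tau z] and [b x && tau z], which
   together cancel the sign in [Et]. *)
have iM z : z != x -> z != y -> idle z M.
  move=> zx zy; split=> a b; rewrite !eM; first by move=> h; rewrite (E0 z) // mulr0 mul0r.
  rewrite Et // !q_flip // mulrA sgnM mulrAC sgnM mulrAC sgnM; congr (sgn _ * _).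
  by case: (q a); case: (q b); case: (a x); case: (b x); case: (tau z).
have pM a b : a x (+) a y != b x (+) b y -> ent M a b = 0.
  by move=> h; rewrite eM Ep // mulr0 mul0r.
have -> : E = Dg q *m M *m Dg q by rewrite /M !mulmxA DgK mul1mx -mulmxA DgK mulmx1.
have [h1 h2] := hS x y xS yS.
have h := impl_conj hD hD (impl_two_site xy h2 h1 uM iM pM).
by apply: (impl_le h) => //; rewrite /pair_cost; lia.
Qed.
End Twisted.

(** * CNOT ladders *)

Section Ladder.
Variable L : nat.
Implicit Types (a b : cfg L) (c : site L * site L) (x y z w : site L) (S T : {set site L}) (l : seq (site L)).

Definition run (cs : seq (site L * site L)) b := foldl (fun b c => cn c.1 c.2 b) b cs.

(** The CNOT into the head comes last, so every site receives the suffix parity already accumulated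
    at its successor. *)
Fixpoint ladder l : seq (site L * site L) :=
  if l is x :: l' then (if l' is y :: _ then rcons (ladder l') (y, x) else [::]) else [::].

Lemma run_rcons cs c b : run (rcons cs c) b = cn c.1 c.2 (run cs b).
Proof. by rewrite /run -cats1 foldl_cat. Qed.

Lemma run_ladder l b z : uniq l ->
  run (ladder l) b z = if z \in l then \xor_(w <- drop (index z l) l) b w else b z.
Proof.
elim: l z => [//|x [|y l] IH] z.
  by move=> _ /=; rewrite inE eq_sym; case: eqP => [->|//]; rewrite big_seq1.
move=> ul; have /andP[xl ul'] : (x \notin y :: l) && uniq (y :: l) by [].
rewrite [ladder _]/(rcons (ladder (y :: l)) (y, x)) run_rcons cnE !IH // mem_head.
rewrite [index y _]/= eqxx drop0 (in_cons x) [index z (x :: _)]/= (eq_sym x).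
case: (eqVneq z x) => [->|zx] //=.
by rewrite (negbTE xl) [RHS]big_cons addbC.
Qed.

Lemma size_ladder l : (size (ladder l) <= size l)%N.
Proof. by elim: l => [//|x [//|y l] IH]; rewrite [ladder _]/(rcons (ladder (y :: l)) (y, x)) size_rcons. Qed.

Lemma mem_ladder l c : c \in ladder l -> c.1 \in l /\ c.2 \in l.
Proof.
elim: l => [//|x [//|y l] IH]; rewrite [ladder _]/(rcons (ladder (y :: l)) (y, x)) mem_rcons in_cons.
by case/orP => [/eqP->/=|/IH[h1 h2]]; split; rewrite ?(in_cons x _ c.1) ?(in_cons x _ c.2) ?h1 ?h2 ?orbT // !inE ?eqxx ?orbT.
Qed.

Definition near (c : site L * site L) := l1 c.1 c.2 == 1%N.

Lemma near_ne c : near c -> c.1 != c.2.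
Proof. by rewrite /near -l1_eq0 => /eqP->. Qed.

Lemma impl_run S cs : all (fun c => [&& near c, c.1 \in S & c.2 \in S]) cs ->
  impl S (Pm (run cs)) (size cs) (size cs).
Proof.
elim/last_ind: cs => [_|cs c IH]; first by have := impl_id S; rewrite -Mn1.
rewrite all_rcons size_rcons => /andP[/and3P[cn1 c1 c2] h].
have -> : Pm (run (rcons cs c)) = gate_op (CNOT c.1 c.2) *m Pm (run cs).
  by rewrite gate_op_CNOT PmM; apply: eq_Mn => // b; rewrite run_rcons.
rewrite -addn1; apply: impl_seq; first exact: IH.
apply: impl_gate; first exact/eqP.
by rewrite subUset !sub1set c1 c2.
Qed.

Lemma run_cat cs cs' b : run (cs ++ cs') b = run cs' (run cs b).
Proof. by rewrite /run foldl_cat. Qed.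

Lemma run_revK cs : all near cs -> cancel (run cs) (run (rev cs)).
Proof.
elim/last_ind: cs => [//|cs c IH]; rewrite all_rcons => /andP[h hs] b.
by rewrite rev_rcons run_rcons /= /run /= cnK ?near_ne // -/(run _ _) IH.
Qed.

Lemma impl_run_conj S cs phi g d : all (fun c => [&& near c, c.1 \in S & c.2 \in S]) cs ->
  impl S (Dg phi) g d ->
  impl S (Dg (fun b => phi (run cs b))) ((size cs).*2 + g) ((size cs).*2 + d).
Proof.
move=> h hp; have hr : all (fun c => [&& near c, c.1 \in S & c.2 \in S]) (rev cs) by rewrite all_rev.
have h1 := impl_run h; have := impl_run hr; rewrite size_rev => h2.
have := impl_conj h1 h2 hp; rewrite Pm_conj //; apply: run_revK.
by apply: sub_all h => c /and3P[].
Qed.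

(* After the suffix ladder on the line [l], the qubit [nth l n] carries the
   parity of the sites of [l] from position [n] on. *)
Lemma impl_line_phase S l (Z : seq (site L)) (nx : site L -> nat) x0 n :
  uniq l -> all near (ladder l) -> {subset l <= S} ->
  (forall z, z \in Z -> z \notin l /\
     ((nx z < size l)%N -> box (nth x0 l (nx z)) z \subset S /\ (l1 (nth x0 l (nx z)) z <= n)%N)) ->
  impl S (Dg (fun b => \xor_(z <- Z) (b z && \xor_(w <- drop (nx z) l) b w)))
    ((size l).*2 + size Z * cz_cost n) ((size l).*2 + size Z * cz_cost n).
Proof.
move=> ul nl lS hZ.
(* A start position beyond the end of the line means an empty tail, hence a trivial sign; the guard
   keeps the default value of [nth] out. *)
pose phi z b := (nx z < size l)%N && (b (nth x0 l (nx z)) && b z).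
have h : impl S (oprod (fun z => Dg (phi z)) Z) (size Z * cz_cost n) (size Z * cz_cost n).
  apply: impl_seq_big => z zZ; have [zl hz] := hZ z zZ; rewrite /phi.
  case: ltnP hz => [lt /(_ isT)[h1 h2]|ge _]; last first.
    by rewrite /= Dg0; apply: (impl_le (impl_id S)).
  by rewrite /=; apply: impl_cz => //; apply: contraNneq zl => <-; rewrite mem_nth.
rewrite oprod_Dg in h.
have hl : all (fun c => [&& near c, c.1 \in S & c.2 \in S]) (ladder l).
  apply/allP => c cl; have [h1 h2] := mem_ladder cl.
  by rewrite (allP nl _ cl) !lS.
have h' := impl_run_conj hl h; have sl := size_ladder l.
have {h'} := impl_le h' (subxx S) (leqnn _) (leqnn _).
set D := Dg _; set D' := Dg _; suff -> : D = D'.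
  by move=> k; apply: (impl_le k) => //; lia.
apply: eq_Dg => b; apply: eq_big_seq => z /hZ[zl _]; rewrite /phi !run_ladder // (negbTE zl).
case: ltnP => [lt|ge]; first by rewrite mem_nth // index_uniq //= andbC.
by rewrite /= (drop_oversize ge) big_nil andbF.
Qed.
End Ladder.
(** * Matrix exponentials *)

(** As in [is_expm], the tolerance ranges over [C]; [0 < e] forces it to be a positive real. *)
Definition cvgC (u : nat -> C) (l : C) :=
  forall e : C, 0 < e -> exists N, forall k, (N <= k)%N -> `|u k - l| < e.

Lemma cvgC_cst l : cvgC (fun=> l) l.
Proof. by move=> e e0; exists 0%N => k _; rewrite subrr normr0. Qed.

Lemma cvgC_ext u v l : (forall k, u k = v k) -> cvgC u l -> cvgC v l.
Proof. by move=> h hu e /hu[N hN]; exists N => k /hN; rewrite h. Qed.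

Lemma cvgC_sub u l (f : nat -> nat) : (forall k, (k <= f k)%N) -> cvgC u l -> cvgC (fun k => u (f k)) l.
Proof. by move=> h hu e /hu[N hN]; exists N => k Nk; apply: hN; apply: leq_trans (h k). Qed.

Lemma cvgC_add u v l m : cvgC u l -> cvgC v m -> cvgC (fun k => u k + v k) (l + m).
Proof.
move=> hu hv e e0; have e2 : 0 < e / 2%:R by rewrite divr_gt0 ?ltr0n.
have [N hN] := hu _ e2; have [M hM] := hv _ e2.
exists (maxn N M) => k; rewrite geq_max => /andP[/hN h1 /hM h2].
rewrite opprD addrACA (le_lt_trans (ler_normD _ _)) //.
by rewrite [e]splitr ltrD.
Qed.

Lemma cvgC_mul u v l m : cvgC u l -> cvgC v m -> cvgC (fun k => u k * v k) (l * m).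
Proof.
move=> hu hv e e0.
pose A := `|l| + 1; pose B := `|m| + 1.
have A0 : 0 < A by rewrite ltr_wpDl ?normr_ge0 ?ltr01.
have B0 : 0 < B by rewrite ltr_wpDl ?normr_ge0 ?ltr01.
have e2 : 0 < e / 2%:R by rewrite divr_gt0 ?ltr0n.
have [N hN] := hu _ (divr_gt0 e2 B0); have [M hM] := hv _ (divr_gt0 e2 A0).
have [P hP] := hv _ ltr01.
exists (maxn N (maxn M P)) => k; rewrite !geq_max => /and3P[/hN h1 /hM h2 /hP h3].
have -> : u k * v k - l * m = (u k - l) * v k + l * (v k - m) by ring.
rewrite (le_lt_trans (ler_normD _ _)) // [e]splitr ltr_leD // normrM.
  have vB : `|v k| <= B.
    rewrite /B -(subrK m (v k)) (le_trans (ler_normD _ _)) // addrC lerD2l ltW //.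
  apply: le_lt_trans (_ : `|u k - l| * B < _); first by rewrite ler_wpM2l.
  by rewrite -ltr_pdivlMr.
apply: le_trans (_ : A * `|v k - m| <= _); first by rewrite ler_wpM2r // lerDl ler01.
by rewrite mulrC -ler_pdivlMr // ltW.
Qed.

Lemma cvgC_conj u l : cvgC u l -> cvgC (fun k => (u k)^*) l^*.
Proof.
by move=> hu e /hu[N hN]; exists N => k /hN; rewrite -rmorphB norm_conjC.
Qed.

Lemma cvgC_uniq u l m : cvgC u l -> cvgC u m -> l = m.
Proof.
move=> hl hm; apply/eqP; rewrite -subr_eq0; apply/negPn/negP => ne.
have e0 : 0 < `|l - m| / 2%:R by rewrite divr_gt0 ?normr_gt0 ?ltr0n.
have [N hN] := hl _ e0; have [M hM] := hm _ e0.
have h1 := hN _ (leq_maxl N M); have h2 := hM _ (leq_maxr N M).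
have : `|l - m| < `|l - m|.
  have e : l - m = (l - u (maxn N M)) + (u (maxn N M) - m) by ring.
  apply: le_lt_trans (_ : `|l - u (maxn N M)| + `|u (maxn N M) - m| < _).
    by rewrite {1}e ler_normD.
  by rewrite [ltRHS]splitr ltrD // distrC.
by rewrite ltxx.
Qed.

Lemma cvgC_sum (I : Type) (r : seq I) (u : I -> nat -> C) l :
  (forall i, cvgC (u i) (l i)) -> cvgC (fun k => \sum_(i <- r) u i k) (\sum_(i <- r) l i).
Proof.
move=> h; elim: r => [|i r IH].
  by rewrite big_nil; apply: cvgC_ext (cvgC_cst 0) => k; rewrite big_nil.
rewrite big_cons; apply: cvgC_ext (cvgC_add (h i) IH) => k; by rewrite big_cons.
Qed.

Definition cvgM n (S : nat -> 'M[C]_n) (E : 'M[C]_n) := forall i j, cvgC (fun k => S k i j) (E i j).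

Lemma cvgM_mul n (S T : nat -> 'M[C]_n) E F : cvgM S E -> cvgM T F ->
  cvgM (fun k => S k *m T k) (E *m F).
Proof.
move=> h1 h2 i j; rewrite mxE; apply: cvgC_ext (cvgC_sum _ _) => [k|l]; first by rewrite mxE.
exact: cvgC_mul.
Qed.

Lemma cvgM_adj n (S : nat -> 'M[C]_n) E : cvgM S E -> cvgM (fun k => adj (S k)) (adj E).
Proof.
move=> h i j; rewrite !mxE; apply: cvgC_ext (cvgC_conj (h j i)) => k; by rewrite !mxE.
Qed.

Lemma cvgM_uniq n (S : nat -> 'M[C]_n) E F : cvgM S E -> cvgM S F -> E = F.
Proof. by move=> h1 h2; apply/matrixP => i j; apply: cvgC_uniq (h1 i j) (h2 i j). Qed.

Lemma cvgM_cst n (E : 'M[C]_n) : cvgM (fun=> E) E.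
Proof. by move=> i j; apply: cvgC_cst. Qed.

Lemma cvgM_ext n (S T : nat -> 'M[C]_n) E : (forall k, S k = T k) -> cvgM S E -> cvgM T E.
Proof. by move=> e h i j; apply: cvgC_ext (h i j) => k; rewrite e. Qed.

Definition psum n (A : 'M[C]_n) k : 'M[C]_n := \sum_(l < k) (l`!%:R)^-1 *: mxpow A l.

Lemma expm_cvg n (A E : 'M[C]_n) : is_expm A E -> cvgM (psum A) E.
Proof. by move=> h i j e /h[N hN]; exists N => k Nk; apply: hN. Qed.

Lemma mxpow_comm n (A X : 'M[C]_n) k : X *m A = A *m X -> X *m mxpow A k = mxpow A k *m X.
Proof.
move=> h; elim: k => [|k IH] /=; first by rewrite mulmx1 mul1mx.
by rewrite /mxpow /= -/(mxpow A k) mulmxA h -mulmxA IH mulmxA.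
Qed.

Lemma psum_comm n (A X : 'M[C]_n) k : X *m A = A *m X -> X *m psum A k = psum A k *m X.
Proof.
move=> h; rewrite /psum mulmx_sumr mulmx_suml; apply: eq_bigr => l _.
by rewrite -scalemxAr -scalemxAl mxpow_comm.
Qed.

(** Commutation holds for every partial sum and passes to the limit by uniqueness of limits. *)
Lemma expm_comm n (A E X : 'M[C]_n) : is_expm A E -> X *m A = A *m X -> X *m E = E *m X.
Proof.
move=> /expm_cvg hE h; apply: cvgM_uniq (cvgM_mul (cvgM_cst X) hE) _.
by apply: cvgM_ext (cvgM_mul hE (cvgM_cst X)) => k; rewrite psum_comm.
Qed.

(** * The exponential series on the imaginary axis *)

Definition esum (z : C) k : C := \sum_(l < k) (l`!%:R)^-1 * z ^+ l.

Lemma ofRD a b : ofR (a + b) = ofR a + ofR b.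
Proof. exact: (rmorphD (real_complex RR)). Qed.
Lemma ofRM a b : ofR (a * b) = ofR a * ofR b.
Proof. exact: (rmorphM (real_complex RR)). Qed.
Lemma ofRX a k : ofR (a ^+ k) = ofR a ^+ k.
Proof. exact: (rmorphXn (real_complex RR)). Qed.
Lemma ofRN a : ofR (- a) = - ofR a.
Proof. exact: (rmorphN (real_complex RR)). Qed.
Lemma ofR_natV k : ofR (k%:R)^-1 = (k%:R)^-1.
Proof. by rewrite [LHS](fmorphV (real_complex RR)) (rmorph_nat (real_complex RR)). Qed.
Lemma ofR1 : ofR 1 = 1.
Proof. by []. Qed.
Lemma iC2 : iC ^+ 2 = -1.
Proof. exact: (sqr_i RR). Qed.
Lemma conj_iC : iC^* = - iC.
Proof. by apply/eqP; rewrite eq_complex /= oppr0 !eqxx. Qed.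
Lemma conj_ofR a : (ofR a)^* = ofR a.
Proof. exact: conjc_real. Qed.
Lemma norm_ofR a : `|ofR a| = ofR `|a|.
Proof. by rewrite [LHS]normc_def /= expr0n addr0 sqrtr_sqr. Qed.

Lemma cvgC_ofR (u : nat -> RR) l : (forall e : RR, 0 < e -> exists N, forall k, (N <= k)%N -> `|u k - l| < e) ->
  cvgC (fun k => ofR (u k)) (ofR l).
Proof.
move=> h e; rewrite ltcE /= => /andP[/eqP Ie Re0]; have [N hN] := h _ Re0.
exists N => k /hN lt; rewrite -ofRN -ofRD norm_ofR ltcE /= Ie eqxx //.
Qed.

Definition cosn (t : RR) (i : nat) : RR := (-1) ^+ i * t ^+ i.*2 / (i.*2)`!%:R.
Definition sinn (t : RR) (i : nat) : RR := (-1) ^+ i * t ^+ i.*2.+1 / (i.*2.+1)`!%:R.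

Lemma esum_cos_sin (t : RR) k : esum (iC * ofR t) k.*2 =
  ofR (\sum_(i < k) cosn t i) + iC * ofR (\sum_(i < k) sinn t i).
Proof.
have ofR0 : ofR 0 = 0 by [].
elim: k => [|k IH]; first by rewrite /esum !big_ord0 ofR0 mulr0 addr0.
have i2 m : iC ^+ m.*2 = ofR ((-1) ^+ m).
  by rewrite -mul2n exprM iC2 ofRX ofRN.
rewrite doubleS /esum !big_ord_recr /= -/(esum _ _) IH !ofRD !exprMn exprS i2.
rewrite /cosn /sinn !ofRM !ofR_natV !ofRX ofRN.
rewrite !ofR1; ring.
Qed.

Lemma infinite_sum_cvg (f : nat -> RR) (l : RR) : Rfunctions.infinite_sum f l ->
  forall e : RR, 0 < e -> exists N, forall k, (N <= k)%N -> `|\sum_(i < k.+1) f i - l| < e.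
Proof.
move=> h e /RltP e0; have [N hN] := h e e0; exists N => k Nk.
have := hN k (elimT ssrnat.leP Nk); rewrite RdistE sum_f_R0E big_mkord => /RltP.
by [].
Qed.

(** Euler's formula, the witnesses being cosine and sine. They are kept abstract because unitarity
    uses only [c ^+ 2 + s ^+ 2 = 1]. *)
Lemma esum_unit (t : RR) : exists c s : RR, c ^+ 2 + s ^+ 2 = 1 /\
  cvgC (fun k => esum (iC * ofR t) k.+1.*2) (ofR c + iC * ofR s).
Proof.
exists (Rtrigo_def.cos t), (Rtrigo_def.sin t); split.
  have := Rtrigo1.sin2_cos2 t; rewrite /RIneq.Rsqr RplusE !RmultE -!expr2 addrC.
  by [].
have hc : forall e : RR, 0 < e -> exists N, forall k, (N <= k)%N -> `|\sum_(i < k.+1) cosn t i - Rtrigo_def.cos t| < e.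
  rewrite /Rtrigo_def.cos; case: Rtrigo_def.exist_cos => l hl.
  move=> e e0; have [N hN] := infinite_sum_cvg hl e0; exists N => k /hN.
  suff -> : \sum_(i < k.+1) Rtrigo_def.cos_n i * Rpow_def.pow (RIneq.Rsqr t) i = \sum_(i < k.+1) cosn t i by [].
  apply: eq_bigr => i _; rewrite /cosn /Rtrigo_def.cos_n RdivE !RpowE INRE factE.
  rewrite /RIneq.Rsqr RmultE -expr2 -exprM mul2n mulrAC.
  by rewrite multE mul2n.
have hs : forall e : RR, 0 < e -> exists N, forall k, (N <= k)%N -> `|\sum_(i < k.+1) sinn t i - Rtrigo_def.sin t| < e.
  rewrite /Rtrigo_def.sin; case: Rtrigo_def.exist_sin => l hl e e0.
  (* The library defines the sine as [t] times a series in the square of [t], so the tolerance is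
     divided by [|t| + 1], which is positive even for [t = 0]. *)
  have t1 : 0 < `|t| + 1 by rewrite ltr_wpDl ?normr_ge0 ?ltr01.
  have [N hN] := infinite_sum_cvg hl (divr_gt0 e0 t1); exists N => k /hN.
  have -> : \sum_(i < k.+1) sinn t i = t * \sum_(i < k.+1) Rtrigo_def.sin_n i * Rpow_def.pow (RIneq.Rsqr t) i.
    rewrite mulr_sumr; apply: eq_bigr => i _; rewrite /sinn /Rtrigo_def.sin_n RdivE !RpowE INRE factE.
    rewrite /RIneq.Rsqr RmultE -expr2 -exprM mul2n exprS.
    by rewrite multE mul2n plusE addn1; ring.
  move=> lt; rewrite RmultE -mulrBr normrM.
  rewrite ltr_pdivlMr // mulrC in lt; apply: le_lt_trans lt.
  by rewrite ler_wpM2r // lerDl.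
apply: cvgC_ext (cvgC_add (cvgC_ofR hc) (cvgC_mul (cvgC_cst iC) (cvgC_ofR hs))) => k.
by rewrite esum_cos_sin.
Qed.

Lemma mxpow_conj n (P Q D : 'M[C]_n) k : P *m Q = 1%:M -> Q *m P = 1%:M ->
  mxpow (Q *m D *m P) k = Q *m mxpow D k *m P.
Proof.
move=> PQ QP; elim: k => [|k IH]; first by rewrite /= mulmx1 QP.
by rewrite /mxpow /= -!/(mxpow _ k) IH !mulmxA -(mulmxA _ P Q) PQ mulmx1.
Qed.

Lemma mxpow_diag n (d : 'rV[C]_n) k : mxpow (diag_mx d) k = diag_mx (map_mx (fun z => z ^+ k) d).
Proof.
elim: k => [|k IH].
  by apply/matrixP => i j; rewrite !mxE expr0; case: eqP.
rewrite /mxpow /= -/(mxpow _ k) IH; apply/matrixP => i j.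
by rewrite mul_diag_mx !mxE exprS; case: eqP => //=; rewrite ?mulr0n ?mulr0.
Qed.

(** Diagonalise [H] with real eigenvalues. The partial sums are then diagonal in the same basis, and
    each diagonal entry times its conjugate tends to [1]. *)
Lemma expm_unitary n (H E : 'M[C]_n) (th : RR) : is_hermitian H ->
  is_expm ((- (iC * ofR th)) *: H) E -> Defs.is_unitary E.
Proof.
move=> hH /expm_cvg hE.
have hh : H \is hermsymmx.
  by apply/is_hermitianmxP; rewrite expr0 scale1r -[LHS]hH adj_tC.
have nH : H \is normalmx by apply/normalmxP; rewrite -!adj_tC hH.
have eH := orthomx_spectralP nH.
set P := spectralmx H in eH; set d := spectral_diag H in eH.
have uP := spectral_unitarymx H.
have P1 : P *m adj P = 1%:M by rewrite adj_tC; exact/unitarymxP.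
have P2 : adj P *m P = 1%:M by apply: mulmx1C.
rewrite (invmx_unitary uP) -adj_tC in eH.
have rd i : exists h : RR, d 0 i = ofR h.
  have /mxOverP /(_ 0 i) := hermitian_spectral_diag_real hh.
  by move/complex_realP.
pose c := - (iC * ofR th).
have cE : c *: H = adj P *m diag_mx (c *: d) *m P.
  rewrite {1}eH scalemxAl scalemxAr; congr (_ *m _ *m _).
  by apply/matrixP => i j; rewrite !mxE mulrnAr.
pose es k : 'rV[C]_n := \row_i esum (c * d 0 i) k.
have pE k : psum (c *: H) k = adj P *m diag_mx (es k) *m P.
  rewrite /psum cE (eq_bigr (fun l : 'I_k => adj P *m ((l`!%:R)^-1 *: diag_mx (map_mx (fun z => z ^+ l) (c *: d))) *m P)).
    rewrite -mulmx_suml -mulmx_sumr; congr (_ *m _ *m _).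
    apply/matrixP => i j; rewrite summxE !mxE /esum -sumrMnl.
    by apply: eq_bigr => l _; rewrite !mxE mulrnAr.
  by move=> l _; rewrite mxpow_conj // mxpow_diag -scalemxAr -scalemxAl.
suff E1 : E *m adj E = 1%:M by split=> //; apply: mulmx1C.
(* Only partial sums of even length are compared with cosine and sine, hence the subsequence. *)
have hE2 : cvgM (fun k => psum (c *: H) k.+1.*2) E.
  by move=> i j; apply: (cvgC_sub (f := fun k => k.+1.*2) _ (hE i j)) => k; lia.
apply: cvgM_uniq (cvgM_mul hE2 (cvgM_adj hE2)) _.
have adjPP : adj (adj P) = P by apply/matrixP => i j; rewrite !mxE conjCK.
have aM (X Y : 'M[C]_n) : adj (X *m Y) = adj Y *m adj X by rewrite /adj map_mxM trmx_mul.
pose w k : 'rV[C]_n := \row_i (es k 0 i * (es k 0 i)^*).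
apply: (@cvgM_ext _ (fun k => adj P *m diag_mx (w k.+1.*2) *m P)).
  move=> k; rewrite pE !aM adjPP !mulmxA -(mulmxA _ P (adj P)) P1 mulmx1.
  congr (_ *m _); rewrite -mulmxA; congr (_ *m _); apply/matrixP => i j.
  rewrite mul_diag_mx !mxE; case: (eqVneq i j) => [->|_]; rewrite ?mulr1n //.
  by rewrite !mulr0n rmorph0 mulr0.
rewrite -P2 -[in X in cvgM _ X](mulmx1 (adj P)).
apply: cvgM_mul (cvgM_cst P); apply: cvgM_mul (cvgM_cst _) _ => i j.
rewrite mxE; apply: (@cvgC_ext (fun k => w k.+1.*2 0 i *+ (i == j))).
  by move=> k; rewrite [RHS]mxE.
case: (i == j); last exact: cvgC_cst.
have [h dh] := rd i.
have [cc [ss [cs1 hcs]]] := esum_unit (- (th * h)).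
have -> : 1%:R = (ofR cc + iC * ofR ss) * (ofR cc + iC * ofR ss)^*.
  rewrite rmorphD rmorphM /= conj_iC !conj_ofR.
  have -> : (ofR cc + iC * ofR ss) * (ofR cc + - iC * ofR ss) = ofR cc ^+ 2 - iC ^+ 2 * ofR ss ^+ 2 by ring.
  by rewrite iC2 mulN1r opprK -!ofRX -ofRD cs1.
apply: cvgC_ext (cvgC_mul hcs (cvgC_conj hcs)) => k.
have ez : iC * ofR (- (th * h)) = c * d 0 i by rewrite ofRN ofRM dh /c; ring.
by rewrite mulr1n !mxE ez.
Qed.
Lemma odd_card (T : finType) (P : pred T) : odd #|[set i | P i]| = \xor_i P i.
Proof.
rewrite -sum1_card (big_morph odd oddD (erefl _)) big_mkcond /=.
by apply: eq_bigr => i _; rewrite inE; case: (P i).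
Qed.

Lemma xor_delta_fin (T : finType) (F : T -> bool) i : \xor_j ((j == i) && F j) = F i.
Proof. by rewrite xor_delta ?index_enum_uniq // mem_index_enum. Qed.

(** * Pair gates *)

Section Fermions.
Variable L : nat.
Implicit Types (E H X : Op L) (a b : cfg L) (x y z w : site L).

Definition r0 y z := (enum_rank y < enum_rank z)%N.

Lemma r0_anti y z : y != z -> r0 z y = ~~ r0 y z.
Proof.
move=> yz; rewrite /r0; case: ltngtP => // e.
by case/eqP: yz; apply/enum_rank_inj/val_inj.
Qed.

Lemma r0_irr y : r0 y y = false.
Proof. by rewrite /r0 ltnn. Qed.

(* Jordan-Wigner string of the mode [z] for the relation [r]. *)
Definition sig (r : rel (site L)) z b := \xor_y (r y z && b y).

Lemma sig_flip r z b w : sig r z (flip b w) = sig r z b (+) r w z.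
Proof.
rewrite /sig -[r w z](xor_delta_fin (fun y => r y z)) -big_split /=.
apply: eq_bigr => y _; rewrite flipE; case: (y == w); rewrite /= ?addbF //.
by case: (r y z); case: (b y).
Qed.

(** Both ladder operators of a mode in one form: [v = true] annihilates, [v = false] creates. *)
Definition ladder_op w v : Op L :=
  Mn (fun b => flip b w) (fun b => if b w == v then sgn (sig r0 w b) else 0).

Lemma c_opE w : c_op w = ladder_op w true.
Proof.
apply: ent_ext => a b; rewrite !ent_mxOf eqb_id andbC; case: eqP => //= _.
by case: (b w) => //; rewrite sgn_exp odd_card.
Qed.

Lemma cdagE w : cdag w = ladder_op w false.
Proof.
rewrite /cdag c_opE; apply: ent_ext => a b; rewrite ent_adj !ent_Mn.
rewrite -eq_flip (eq_sym _ a); case: eqP => [->|]; last by rewrite rmorph0.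
rewrite flip_at sig_flip r0_irr addbF.
by case: (b w); rewrite /= ?rmorph0 ?conj_sgn.
Qed.

Lemma parity2E x y : parity2 x y = Dg (fun b => b x (+) b y).
Proof.
have h w : 1%:M - 2%:R *: num_op w = Dg (fun b => b w).
  apply: ent_ext => a b; rewrite /num_op c_opE cdagE MnM.
  have -> (A B : Op L) : ent (A - 2%:R *: B) a b = ent A a b - 2%:R * ent B a b by rewrite /ent !mxE.
  rewrite ent1 !ent_Mn flipK; case: eqP => [_|]; last by rewrite mulr0 subr0.
  rewrite flip_at sig_flip r0_irr addbF; case: (b w) => /=; rewrite ?mulr0 ?subr0 //.
  by rewrite sgn_sq mulr1 /sgn; ring.
by rewrite /parity2 !h DgM.
Qed.

Lemma gen_algebra_comm gens X H : in_gen_algebra gens H ->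
  (forall g, g \in gens -> X *m g = g *m X) -> X *m H = H *m X.
Proof.
move=> [s [hs ->]] hg; rewrite mulmx_sumr mulmx_suml; apply: eq_big_seq => w ws.
rewrite -scalemxAr -scalemxAl; congr (_ *: _).
elim: (w.2) (allP hs w ws) => [|g l IH] /=; first by rewrite mulmx1 mul1mx.
by case/andP=> gg /IH e; rewrite mulmxA (hg _ gg) -!mulmxA; congr (_ *m _).
Qed.

Section Pair.
Variables x y : site L.
Hypothesis xy : x != y.

Definition gens := [:: c_op x; cdag x; c_op y; cdag y].

Lemma gensP g : g \in gens -> exists w v, (w == x) || (w == y) /\ g = ladder_op w v.
Proof.
rewrite !inE => /or4P[]/eqP->.
- by exists x, true; rewrite eqxx c_opE.
- by exists x, false; rewrite eqxx cdagE.
- by exists y, true; rewrite eqxx orbT c_opE.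
- by exists y, false; rewrite eqxx orbT cdagE.
Qed.

(* Parity of the pair times the Majorana operator of a third mode [z]: it
   commutes with the ladder operators of [x] and [y], whereas the Majorana
   operator alone anticommutes with them. *)
Definition Gam z : Op L := Mn (fun b => flip b z) (fun b => sgn (b x (+) b y (+) sig r0 z b)).

Lemma gen_Z z g : z != x -> z != y -> g \in gens -> Dg (fun b => b z) *m g = g *m Dg (fun b => b z).
Proof.
move=> zx zy /gensP[w [v [hw ->]]]; have zw : z != w by case/orP: hw => /eqP->.
rewrite /Dg /Dp /ladder_op !MnM; apply: eq_Mn => // b.
by rewrite flip_ne // mulrC.
Qed.

Lemma gen_Gam z g : z != x -> z != y -> g \in gens -> Gam z *m g = g *m Gam z.
Proof.
move=> zx zy /gensP[w [v [hw ->]]]; have zw : z != w by case/orP: hw => /eqP->.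
rewrite /Gam /ladder_op !MnM; apply: eq_Mn => b; first by rewrite flipC.
rewrite (flip_ne _ (x := z) (z := w)) 1?eq_sym //.
case: ifP => _; last by rewrite mulr0 mul0r.
rewrite !sgnM; congr sgn; rewrite !sig_flip (r0_anti zw).
have -> : flip b w x (+) flip b w y = ~~ (b x (+) b y).
  case/orP: hw => /eqP->; first by rewrite flip_at flip_ne 1?eq_sym // addNb.
  by rewrite flip_at flip_ne // addbN.
case: (b x (+) b y); case: (sig r0 z b); case: (r0 z w); by case: (sig r0 w b).
Qed.

Section Struct.
Variables (H E : Op L) (th : RR).
Hypothesis hH : is_hermitian H.
Hypothesis pH : parity_even x y H.
Hypothesis aH : in_gen_algebra gens H.
Hypothesis eE : is_expm ((- (iC * ofR th)) *: H) E.

Lemma comm_E X : X *m H = H *m X -> X *m E = E *m X.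
Proof. by move=> h; apply: (expm_comm eE); rewrite -scalemxAr -scalemxAl h. Qed.

(** The entrywise form of commutation with a diagonal sign: entries between different eigenvalues
    vanish. *)
Lemma sgn_comm0 (p q : bool) (e : C) : sgn p * e = e * sgn q -> p != q -> e = 0.
Proof.
move=> h pq; have /eqP : (2%:R : C) * e = 0.
  case: p pq h; case: q => // _; rewrite /sgn ?mulN1r ?mul1r ?mulr1 ?mulrN1 => h.
    by rewrite mulr_natl mulr2n -{1}h addNr.
  by rewrite mulr_natl mulr2n {1}h addNr.
by rewrite mulf_eq0 pnatr_eq0 => /eqP.
Qed.

Lemma E_diag_off z a b : z != x -> z != y -> a z != b z -> ent E a b = 0.
Proof.
move=> zx zy; apply: sgn_comm0.
have h : Dg (fun b => b z) *m E = E *m Dg (fun b => b z).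
  by apply: comm_E; apply: gen_algebra_comm aH _ => g; apply: gen_Z.
by have := congr1 (fun A => ent A a b) h; rewrite ent_Dp_l ent_Dp_r.
Qed.

Lemma E_parity a b : a x (+) a y != b x (+) b y -> ent E a b = 0.
Proof.
apply: sgn_comm0; have h := comm_E pH; rewrite parity2E in h.
by have := congr1 (fun A => ent A a b) h; rewrite ent_Dp_l ent_Dp_r.
Qed.

Lemma E_Gam z a b : z != x -> z != y -> ent E (flip a z) (flip b z) =
  sgn (a x (+) a y (+) sig r0 z a (+) (b x (+) b y (+) sig r0 z b)) * ent E a b.
Proof.
move=> zx zy; have h : Gam z *m E = E *m Gam z.
  by apply: comm_E; apply: gen_algebra_comm aH _ => g; apply: gen_Gam.
have := congr1 (fun A => ent A (flip a z) b) h.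
rewrite ent_mulMn (ent_Mnmul (g := fun b => flip b z)); [|exact: flipK|exact: flipK].
rewrite flipK => e; rewrite -sgnM -mulrA [X in _ = _ * X]mulrC mulrA e -mulrA sgn_sq mulr1 //.
Qed.

Lemma E_unitary : Defs.is_unitary E.
Proof. exact: expm_unitary hH eE. Qed.

(** Conjugation by [Dg q] exchanges the strings of [r0] for those of [r]. On nonzero entries [a] and
    [b] differ at both of [x] and [y] or nowhere, so the string of a third mode [z] changes by
    [r x z (+) r y z], which vanishes outside [S]. *)
Lemma impl_E n (S : {set site L}) (r : rel (site L)) (q : cfg L -> bool) : x \in S -> y \in S ->
  (forall u v, u \in S -> v \in S -> box u v \subset S /\ (l1 u v <= n)%N) ->
  (forall z b, q (flip b z) = q b (+) sig r0 z b (+) sig r z b) ->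
  (forall z, z \notin S -> r x z = r y z) ->
  impl S (Dg q *m E *m Dg q) (pair_cost #|S| n) (pair_cost #|S| n).
Proof.
move=> xS yS hS hq hr.
have eE' a b : ent (Dg q *m E *m Dg q) a b = sgn (q a) * ent E a b * sgn (q b).
  by rewrite ent_Dp_r ent_Dp_l.
apply: (impl_twisted (tau := fun z => r x z (+) r y z) xy xS yS hS).
- by apply: unitaryM; [apply: unitaryM => //; [|exact: E_unitary]|]; split; rewrite adj_Dg DgK.
- by move=> z a b zx zy h; rewrite eE' (E_diag_off zx zy h) mulr0 mul0r.
- by move=> a b h; rewrite eE' (E_parity h) mulr0 mul0r.
- move=> z a b zx zy; rewrite !eE' E_Gam //.
  case: (eqVneq (ent E a b) 0) => [->|e0]; first by rewrite !(mulr0, mul0r).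
  have hp : a x (+) a y = b x (+) b y.
    by apply/eqP; apply: contraNT e0 => /E_parity->.
  have ho w : w != x -> w != y -> a w = b w.
    by move=> wx wy; apply/eqP; apply: contraNT e0 => /(E_diag_off wx wy)->.
  have hs : sig r z a = sig r z b (+) ((a x (+) b x) && (r x z (+) r y z)).
    have -> : (a x (+) b x) && (r x z (+) r y z) =
      \xor_w ((w == x) && (r w z && (a w (+) b w))) (+) \xor_w ((w == y) && (r w z && (a w (+) b w))).
      rewrite !xor_delta_fin; move: hp.
      by case: (a x); case: (a y); case: (b x); case: (b y); case: (r x z); case: (r y z).
    rewrite /sig -!big_split /=; apply: eq_bigr => w _.
    case: (eqVneq w x) => [->|wx] /=.
      by rewrite (negbTE xy) /=; case: (r x z); case: (a x); case: (b x).
    case: (eqVneq w y) => [->|wy] /=; first by case: (r y z); case: (a y); case: (b y).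
    by rewrite ho // addbF.
  have m1 (p1 p2 p3 : bool) e : sgn p1 * (sgn p2 * e) * sgn p3 = sgn (p1 (+) p2 (+) p3) * e.
    by rewrite -!sgnM; ring.
  have m2 (p1 p2 p3 : bool) e : sgn p1 * (sgn p2 * e * sgn p3) = sgn (p1 (+) p2 (+) p3) * e.
    by rewrite -!sgnM; ring.
  rewrite m1 m2 !hq hs hp; congr (sgn _ * _).
  by case: (q a); case: (q b); case: (sig r0 z a); case: (sig r0 z b); case: (sig r z b);
    case: (b x); case: (b y); case: (a x); case: (r x z); case: (r y z).
- by move=> z /hr->; rewrite addbb.
Qed.

End Struct.
End Pair.
End Fermions.

(** * Lexicographic form of the reference order, and lattice lines *)

Lemma enum_rankE (T : finType) (p : T) : enum_rank p = index p (enum T) :> nat.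
Proof.
rewrite -{2}[p]enum_rankK /enum_val index_uniq ?enum_uniq // -cardE.
exact: ltn_ord.
Qed.

Lemma index_allpairs (T1 T2 : eqType) (s1 : seq T1) (s2 : seq T2) p q : q \in s2 ->
  p \in s1 -> index (p, q) [seq (u, v) | u <- s1, v <- s2] = (index p s1 * size s2 + index q s2)%N.
Proof.
move=> qs; elim: s1 => //= u s1 IH; rewrite inE index_cat size_map.
have [e|ne] := eqVneq p u.
  by rewrite -e map_f // => _; rewrite ?eqxx index_map // => v v' [].
move=> /= /IH->; case: mapP => [[v _ [e]]|_]; last by rewrite mulSn addnA.
by rewrite e eqxx in ne.
Qed.

(** A product is enumerated row by row, so the rank of a pair is a two-digit number with the second
    rank as low digit. *)
Lemma rank_pair (T1 T2 : finType) (p q : T1 * T2) : (enum_rank p < enum_rank q)%N =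
  (enum_rank p.1 < enum_rank q.1)%N || (p.1 == q.1) && (enum_rank p.2 < enum_rank q.2)%N.
Proof.
have e (u : T1 * T2) : enum_rank u = (enum_rank u.1 * size (enum T2) + enum_rank u.2)%N :> nat.
  rewrite !enum_rankE -index_allpairs ?mem_enum // -surjective_pairing; congr index.
  by rewrite enumT unlock.
have h2 (v : T2) : (enum_rank v < size (enum T2))%N by rewrite -cardE ltn_ord.
rewrite !e; have := h2 p.2; have := h2 q.2.
case: (eqVneq p.1 q.1) => [->|ne]; first by rewrite ltn_add2l ltnn.
have : enum_rank p.1 != enum_rank q.1 :> nat by rewrite (inj_eq val_inj) (inj_eq enum_rank_inj).
move: (enum_rank p.1 : nat) (enum_rank q.1 : nat) (enum_rank p.2 : nat) (enum_rank q.2 : nat) (size _) => u v u' v' n.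
rewrite /= orbF; nia.
Qed.

Lemma r0E L (y z : site L) : r0 y z =
  [|| (y.1.1 < z.1.1)%N, (y.1.1 == z.1.1) && (y.1.2 < z.1.2)%N |
      [&& y.1.1 == z.1.1, y.1.2 == z.1.2 & (y.2 < z.2)%N]].
Proof.
case: y z => [[y1 y2] y3] [[z1 z2] z3].
by rewrite /r0 !rank_pair !enum_rank_ord /= xpair_eqE -orbA -!andbA.
Qed.
Lemma drop_enum_ord L n : drop n (enum 'I_L) = [seq k : 'I_L <- enum 'I_L | (n <= k)%N].
Proof.
apply: (inj_map val_inj).
rewrite map_drop -[filter _ _]/(filter (preim val (leq n)) _) -filter_map val_enum_ord.
apply: (irr_sorted_eq ltn_trans ltnn).
- by apply: drop_sorted; apply: iota_ltn_sorted.
- by apply: sorted_filter (iota_ltn_sorted _ _); apply: ltn_trans.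
- by move=> k; rewrite drop_iota mem_filter !mem_iota; lia.
Qed.

Lemma xor_drop L (T : Type) (f : 'I_L -> T) (F : T -> bool) n :
  \xor_(w <- drop n (map f (enum 'I_L))) F w = \xor_(k | (n <= nat_of_ord k)%N) F (f k).
Proof. by rewrite -map_drop big_map drop_enum_ord big_filter big_enum_cond. Qed.

Lemma ladder_near L (l : seq (site L)) :
  all (@near L) (ladder l) = sorted (fun x y => near (y, x)) l.
Proof.
elim: l => [//|x [//|y l] IH]; rewrite [ladder _]/(rcons (ladder (y :: l)) (y, x)).
by rewrite all_rcons IH.
Qed.

Lemma line_near L (f : 'I_L -> site L) :
  (forall p q : 'I_L, q = p.+1 :> nat -> near (f q, f p)) -> all (@near L) (ladder (map f (enum 'I_L))).
Proof.
move=> h; rewrite ladder_near sorted_map.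
have : sorted (fun p q => q == p.+1) (map val (enum 'I_L)).
  rewrite val_enum_ord; elim: L 0%N {f h} => // -[//|n] IH m.
  by rewrite /= eqxx; apply: (IH m.+1).
by rewrite sorted_map; apply: sub_sorted => p q /eqP; apply: h.
Qed.

(** * Inversions of the block order *)

Section Quadratic.
Variable L : nat.
Implicit Types (b : cfg L) (x y z w : site L) (R : rel (site L)).

(** The quadratic form over the two-element field with coefficient matrix [R]; a bit flip changes it
    by the symmetrised matrix. *)
Definition Qf R b := \xor_z \xor_w (R z w && (b z && b w)).

Lemma Qf_flip R b x : R x x = false ->
  Qf R (flip b x) = Qf R b (+) \xor_w ((R x w (+) R w x) && b w).
Proof.
move=> Rx; rewrite /Qf.
have -> : \xor_w ((R x w (+) R w x) && b w) =
   (\xor_z ((z == x) && \xor_w (R z w && b w))) (+) (\xor_z \xor_w ((w == x) && (R z w && b z)))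
    (+) (\xor_z ((z == x) && \xor_w ((w == x) && R z w))).
  have -> : \xor_z \xor_w ((w == x) && (R z w && b z)) = \xor_z (R z x && b z).
    by apply: eq_bigr => z _; exact: (xor_delta_fin (fun w => R z w && b z) x).
  rewrite !(xor_delta_fin _ x) Rx addbF.
  by rewrite -big_split; apply: eq_bigr => w _; rewrite /= andb_addl.
rewrite -!big_split; apply: eq_bigr => z _ /=; rewrite -!xor_andr -!big_split /=.
apply: eq_bigr => w _; rewrite !flipE.
by case: (z == x); case: (w == x); case: (R z w); case: (b z); case: (b w).
Qed.

End Quadratic.

Section Blocks.
Variables (L B t1 t2 t3 : nat).
Hypothesis B0 : (0 < B)%N.
Implicit Types (b : cfg L) (x y z w : site L) (R : rel (site L)).

Definition blk (t c : nat) := ((c + t) %/ B)%N.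
Definition blk1 z := blk t1 z.1.1.
Definition blk2 z := blk t2 z.1.2.
Definition blk3 z := blk t3 z.2.

Lemma blk_mono t p q : (p <= q)%N -> (blk t p <= blk t q)%N.
Proof. by move=> h; apply: leq_div2r; rewrite leq_add2r. Qed.

Lemma blk_mid t p q r v : blk t p = v -> blk t q = v -> mid p q r -> blk t r = v.
Proof.
by move=> hp hq /orP[]/andP[/(blk_mono t) h1 /(blk_mono t) h2]; lia.
Qed.

Lemma blk_dist t p q : blk t p = blk t q -> (absd p q < B)%N.
Proof.
rewrite /blk => e; have := divn_eq (p + t) B; have := divn_eq (q + t) B.
have := ltn_pmod (p + t) B0; have := ltn_pmod (q + t) B0; rewrite e /absd; lia.
Qed.

(** The first coordinate after the block of [p], possibly outside the lattice. The subtraction never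
    truncates, since [(blk t p).+1 * B] exceeds [p + t]. *)
Definition nxt t p := ((blk t p).+1 * B - t)%N.

Lemma nxtP t p q : (nxt t p <= q)%N = (blk t p < blk t q)%N.
Proof. by rewrite /nxt leq_subLR addnC /blk -leq_divRL. Qed.

Lemma nxt_dist t p : (absd (nxt t p) p <= B)%N.
Proof.
rewrite /nxt /blk; have := divn_eq (p + t) B; have := ltn_pmod (p + t) B0.
by rewrite /absd mulSn; lia.
Qed.

Definition rb z w := [|| (blk1 z < blk1 w)%N, (blk1 z == blk1 w) && (blk2 z < blk2 w)%N,
   [&& blk1 z == blk1 w, blk2 z == blk2 w & (blk3 z < blk3 w)%N] |
   [&& blk1 z == blk1 w, blk2 z == blk2 w, blk3 z == blk3 w & r0 z w]].

(* Inversions between [r0] and [rb], sorted according to the first block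
   coordinate in which the two sites differ. *)
Definition R1 z w := [&& blk1 z == blk1 w, (z.1.1 < w.1.1)%N & (blk2 w < blk2 z)%N].
Definition R2 z w := [&& blk1 z == blk1 w, blk2 z == blk2 w,
  (z.1.1 < w.1.1)%N || (z.1.1 == w.1.1) && (z.1.2 < w.1.2)%N & (blk3 w < blk3 z)%N].

(** By monotonicity of [blk], sites in different first blocks are ordered alike by both relations,
    and a difference in a later block number reverses two sites only if an earlier coordinate orders
    them the other way. What is left is a case check on natural numbers. *)
Lemma inversions z w : R1 z w (+) R1 w z (+) (R2 z w (+) R2 w z) = r0 w z (+) rb w z.
Proof.
rewrite /rb /R1 /R2 !r0E -!val_eqE /=.
have m1 := @blk_mono t1 z.1.1 w.1.1; have m1' := @blk_mono t1 w.1.1 z.1.1.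
have m2 := @blk_mono t2 z.1.2 w.1.2; have m2' := @blk_mono t2 w.1.2 z.1.2.
have m3 := @blk_mono t3 z.2 w.2; have m3' := @blk_mono t3 w.2 z.2.
rewrite -/(blk1 _) -/(blk1 _) in m1 m1'; rewrite -/(blk2 _) -/(blk2 _) in m2 m2'; rewrite -/(blk3 _) -/(blk3 _) in m3 m3'.
move: (blk1 z) (blk1 w) (blk2 z) (blk2 w) (blk3 z) (blk3 w) m1 m1' m2 m2' m3 m3'.
move: (z.1.1 : nat) (w.1.1 : nat) (z.1.2 : nat) (w.1.2 : nat) (z.2 : nat) (w.2 : nat).
move=> i i' j j' k k' I I' J J' K K'.
case: (ltngtP i i') => hi; case: (ltngtP I I') => hI; rewrite /= ?andbF ?orbF //; try lia;
case: (ltngtP j j') => hj; case: (ltngtP J J') => hJ; rewrite /= ?andbF ?orbF //; try lia;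
case: (ltngtP k k') => hk; case: (ltngtP K K') => hK; rewrite /= ?andbF ?orbF //; lia.
Qed.

Definition qt b := Qf R1 b (+) Qf R2 b.

(** Exactly the condition on [q] in [impl_E], with [rb] as the new order. *)
Lemma qt_flip z b : qt (flip b z) = qt b (+) sig (@r0 L) z b (+) sig rb z b.
Proof.
rewrite /qt !Qf_flip; [|by rewrite /R2 !ltnn !andbF|by rewrite /R1 ltnn andbF].
rewrite -!addbA; congr (_ (+) _); rewrite addbCA; congr (_ (+) _).
rewrite /sig -!big_split; apply: eq_bigr => w _ /=.
by rewrite -!andb_addl inversions.
Qed.

(** Blocks are intervals of [rb]; this confines the string of a pair to its block. *)
Lemma rb_block x y z : blk1 x = blk1 y -> blk2 x = blk2 y -> blk3 x = blk3 y ->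
  ~~ [&& blk1 z == blk1 x, blk2 z == blk2 x & blk3 z == blk3 x] -> rb x z = rb y z.
Proof.
move=> e1 e2 e3; rewrite /rb -e1 -e2 -e3 (eq_sym (blk1 z)) (eq_sym (blk2 z)) (eq_sym (blk3 z)).
by case: (blk1 x == blk1 z); case: (blk2 x == blk2 z); case: (blk3 x == blk3 z).
Qed.

End Blocks.

(** * Regrouping of parity sums *)

Lemma xor_xorC (I J : finType) (F : I -> J -> bool) :
  \xor_i \xor_j F i j = \xor_j \xor_i F i j.
Proof. exact: exchange_big. Qed.

Lemma xor_pair (I J : finType) (F : I * J -> bool) :
  \xor_p F p = \xor_i \xor_j F (i, j).
Proof. by rewrite pair_bigA /=; apply: eq_bigr => -[]. Qed.

Lemma xor_partition (I : finType) (K : eqType) (f : I -> K) (F : I -> bool) :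
  \xor_i F i = \xor_(v <- undup (map f (enum I))) \xor_(i <- [seq i <- enum I | f i == v]) F i.
Proof.
under [RHS]eq_bigr => v _ do rewrite big_filter big_mkcond /= big_enum /=.
rewrite exchange_big /=; apply: eq_big => [i|i _]; first by rewrite inE.
transitivity (\xor_(v <- undup (map f (enum I))) ((v == f i) && F i)).
  by rewrite (xor_delta (fun=> F i)) ?undup_uniq // mem_undup map_f ?mem_enum.
by apply: eq_bigr => v _; rewrite eq_sym; case: ifP.
Qed.

Lemma xor_filter (I : finType) (P F : I -> bool) :
  \xor_(i <- [seq i <- enum I | P i]) F i = \xor_i (P i && F i).
Proof. by rewrite big_filter big_mkcond /= big_enum /=; apply: eq_big => [i|i _]; [rewrite inE|case: (P i)]. Qed.

Lemma xor_cond (I : finType) (P F : I -> bool) : \xor_(i | P i) F i = \xor_i (P i && F i).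
Proof. by rewrite big_mkcond; apply: eq_bigr => i _; case: (P i). Qed.

Lemma size_filter_inj (I J : finType) (P : pred I) (f : I -> J) :
  {in P &, injective f} -> (size [seq i <- enum I | P i] <= #|J|)%N.
Proof.
move=> h; have -> : size [seq i <- enum I | P i] = #|P|.
  by rewrite -sum1_card -sum1_size big_filter big_enum_cond; apply: eq_bigl => i; rewrite inE.
exact: (@leq_card_in _ _ f P h).
Qed.

(** * Circuits for the reordering signs *)

Section Slabs.
Variables (L' B t1 t2 t3 : nat).
(** A nonempty lattice provides [ord0]; the empty one is treated in the final proof. *)
Let L := L'.+1.
Hypothesis B0 : (0 < B)%N.
Implicit Types (b : cfg L) (x y z w : site L).
Local Notation blk := (blk B).
Local Notation blk1 := (blk1 B t1).
Local Notation blk2 := (blk2 B t2).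
Local Notation blk3 := (blk3 B t3).

(** Position inside the block. Together with the block number it determines the coordinate, which
    yields all cardinality bounds in terms of [B]. *)
Definition blk_offset t (p : nat) : 'I_B := Ordinal (ltn_pmod (p + t) B0).

Lemma blk_offset_inj t (p q : 'I_L) : blk t p = blk t q -> blk_offset t p = blk_offset t q -> p = q.
Proof.
move=> e [e']; apply/val_inj => /=; apply/eqP; rewrite -(eqn_add2r t).
by rewrite (divn_eq (p + t)%N B) (divn_eq (q + t)%N B) e' -/(blk t p) -/(blk t q) e.
Qed.

(** A controlled sign spans less than [B] in each coordinate whose block is shared, and at most [B]
    from a site to the start of the next block. *)
Definition czB := cz_cost (3 * B).
(** Up to [B * B] lines per column of blocks, each with a ladder, its inverse and at most
    [B * B * L] controlled signs; the common factor [L] is taken out. *)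
Definition col_cost := (B * B * (2 + B * B * czB))%N.

Definition kline (p : 'I_L * 'I_L) : seq (site L) := [seq (p, k) | k <- enum 'I_L].

Lemma kline_uniq p : uniq (kline p).
Proof. by rewrite map_inj_uniq ?enum_uniq // => k k' []. Qed.

Lemma mem_kline p z : (z \in kline p) = (z.1 == p).
Proof.
apply/mapP/eqP => [[k _ ->//]|<-].
by exists z.2; rewrite ?mem_enum // -surjective_pairing.
Qed.

Lemma kline_near p : all (@near L) (ladder (kline p)).
Proof. by apply: line_near => k k' e; rewrite /near /l1 /absd /= e; lia. Qed.

Lemma size_kline p : size (kline p) = L.
Proof. by rewrite size_map size_enum_ord. Qed.

Lemma nth_kline p n : (n < L)%N -> exists2 k : 'I_L, nth (ord0, ord0, ord0) (kline p) n = (p, k) & k = n :> nat.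
Proof.
move=> h; exists (nth ord0 (enum 'I_L) n); last by rewrite nth_enum_ord.
by rewrite (nth_map ord0) // size_enum_ord.
Qed.

Definition lt2 (p q : 'I_L * 'I_L) := (p.1 < q.1)%N || (p.1 == q.1) && (p.2 < q.2)%N.

Definition colZ (p : 'I_L * 'I_L) :=
  [seq w <- enum (site L) | [&& blk t1 p.1 == blk1 w, blk t2 p.2 == blk2 w & lt2 p w.1]].

Definition Psi2 (p : 'I_L * 'I_L) b :=
  \xor_(w <- colZ p) (b w && \xor_(z <- drop (nxt B t3 w.2) (kline p)) b z).

Lemma xor_site (F : site L -> bool) : \xor_z F z = \xor_p \xor_k F (p, k).
Proof. exact: xor_pair. Qed.

(** For a fixed line and a fixed [w], the sites of the line in a later third block form a tail
    starting at [nxt], so the inner sum is a tail parity. *)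
Lemma Qf_R2 b : Qf (R2 B t1 t2 t3) b = \xor_p Psi2 p b.
Proof.
rewrite /Qf xor_site; apply: eq_bigr => p _; rewrite xor_xorC /Psi2 xor_filter.
apply: eq_bigr => w _; rewrite xor_drop -!xor_andr [RHS]xor_cond; apply: eq_bigr => k _.
rewrite nxtP // /R2 /lt2 /blk1 /blk2 /blk3 /=.
case: (blk t1 p.1 == blk t1 w.1.1); rewrite /= ?andbF //.
case: (blk t2 p.2 == blk t2 w.1.2); rewrite /= ?andbF //.
case: (_ || _); rewrite /= ?andbF //.
by case: (_ < _)%N; case: (b w); case: (b _).
Qed.

(** Lines in the same column of blocks are treated one after another, different columns in
    parallel. *)
Lemma impl_R2 : impl [set: site L] (Dg (Qf (R2 B t1 t2 t3))) (col_cost * L ^ 3) (col_cost * L).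
Proof.
pose f (p : 'I_L * 'I_L) := (blk t1 p.1, blk t2 p.2).
pose r := undup (map f (enum (prod 'I_L 'I_L : finType))).
pose g := ((B * B) * (L.*2 + (B * B * L) * czB))%N.
have h v : v \in r -> impl [set z : site L | f z.1 == v]
    (Dg (fun b => \xor_(p <- [seq p <- enum (prod 'I_L 'I_L : finType) | f p == v]) Psi2 p b)) g g.
  move=> _; rewrite -oprod_Dg.
  have hp p : p \in [seq p <- enum (prod 'I_L 'I_L : finType) | f p == v] ->
     impl [set z : site L | f z.1 == v] (Dg (Psi2 p)) (L.*2 + (B * B * L) * czB) (L.*2 + (B * B * L) * czB).
    rewrite mem_filter => /andP[/eqP fp _].
    have sZ : (size (colZ p) <= B * B * L)%N.
      have := @size_filter_inj (site L) ('I_B * 'I_B * 'I_L)%type _ (fun w => (blk_offset t1 w.1.1, blk_offset t2 w.1.2, w.2)) _.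
      rewrite !card_prod !card_ord; apply.
      move=> w w' /and3P[/eqP h1 /eqP h2 _] /and3P[/eqP h1' /eqP h2' _] [e1 e2 e3].
      have {}e1 : w.1.1 = w'.1.1 by apply: (@blk_offset_inj t1); [rewrite -[LHS]h1 | apply/val_inj].
      have {}e2 : w.1.2 = w'.1.2 by apply: (@blk_offset_inj t2); [rewrite -[LHS]h2 | apply/val_inj].
      by case: w w' e1 e2 e3 {h1 h2 h1' h2'} => [[? ?] ?] [[? ?] ?] /= -> -> ->.
    have hl := @impl_line_phase L [set z : site L | f z.1 == v] (kline p) (colZ p)
      (fun w => nxt B t3 w.2) (ord0, ord0, ord0) (3 * B) (kline_uniq p) (kline_near p).
    rewrite size_kline in hl; apply: impl_le (hl _ _) (subxx _) _ _.
    - by move=> z; rewrite mem_kline inE => /eqP->; apply/eqP.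
    - move=> w; rewrite mem_filter => /andP[/and3P[/eqP h1 /eqP h2 h3] _]; split.
        by rewrite mem_kline; apply: contraTneq h3 => ->; rewrite /lt2 !ltnn andbF.
      move=> /(nth_kline p)[k -> ek]; split.
        apply/subsetP => z; rewrite !inE /= => /and3P[m1 m2 _].
        rewrite -fp /f xpair_eqE; apply/andP; split; apply/eqP.
          by apply: blk_mid m1 => //; rewrite -[LHS]h1.
        by apply: blk_mid m2 => //; rewrite -[LHS]h2.
      rewrite /l1 /= ek; have := nxt_dist B0 t3 w.2.
      have := blk_dist B0 h1; have := blk_dist B0 h2.
      by move: (absd p.1 _) (absd p.2 _) (absd (nxt _ _ _) _) => u1 u2 u3; lia.
    - by rewrite leq_add2l leq_mul2r sZ orbT.
    - by rewrite leq_add2l leq_mul2r sZ orbT.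
  have sv : (size [seq p <- enum (prod 'I_L 'I_L : finType) | f p == v] <= B * B)%N.
    have := @size_filter_inj (prod 'I_L 'I_L : finType) ('I_B * 'I_B)%type _ (fun p => (blk_offset t1 p.1, blk_offset t2 p.2)) _.
    rewrite !card_prod !card_ord; apply.
    move=> p p' /eqP hp1 /eqP hp2 [e1 e2].
    have [h1 h2] : f p = f p' by rewrite hp1 hp2.
    have {}e1 : p.1 = p'.1 by apply: (@blk_offset_inj t1) => //; apply/val_inj.
    have {}e2 : p.2 = p'.2 by apply: (@blk_offset_inj t2) => //; apply/val_inj.
    by case: p p' e1 e2 {hp1 hp2 h1 h2} => [? ?] [? ?] /= -> ->.
  by apply: impl_le (impl_seq_big hp) (subxx _) _ _; rewrite leq_mul2r sv orbT.
have hr := impl_par_big (f := fun z : site L => f z.1) (undup_uniq _) h.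
rewrite oprod_Dg in hr.
rewrite (eq_Dg (q := fun b => \xor_(v <- r) \xor_(p <- [seq p <- enum (prod 'I_L 'I_L : finType) | f p == v]) Psi2 p b)); last first.
  by move=> b; rewrite Qf_R2 (xor_partition f).
have sr : (size r <= L * L)%N.
  by rewrite (leq_trans (size_undup _)) // size_map -cardE card_prod card_ord.
have gE : g = (col_cost * L)%N by rewrite /g /col_cost -mul2n; lia.
apply: impl_le hr (subsetT _) _ _; last by rewrite gE.
rewrite gE !expnS expn0 muln1; apply: leq_trans (leq_mul sr (leqnn _)) _.
by move: col_cost L => u v; nia.
Qed.

Definition row0 (i : 'I_L) : seq (site L) := [seq (i, j, ord0) | j <- enum 'I_L].

Lemma row0_uniq i : uniq (row0 i).
Proof. by rewrite map_inj_uniq ?enum_uniq // => k k' []. Qed.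

Lemma row0_near i : all (@near L) (ladder (row0 i)).
Proof. by apply: line_near => k k' e; rewrite /near /l1 /absd /= e; lia. Qed.

Lemma size_row0 i : size (row0 i) = L.
Proof. by rewrite size_map size_enum_ord. Qed.

Lemma nth_row0 i n : (n < L)%N -> exists2 j : 'I_L, nth (ord0, ord0, ord0) (row0 i) n = (i, j, ord0) & j = n :> nat.
Proof.
move=> h; exists (nth ord0 (enum 'I_L) n); last by rewrite nth_enum_ord.
by rewrite (nth_map ord0) // size_enum_ord.
Qed.

(* Once the ladders on the [k]-lines have moved the parity of every line to the
   plane [k = 0], the inversions [R1] are phases between lines of that plane. *)
Definition slabZ (i : 'I_L) :=
  [seq w <- enum (site L) | [&& w.2 == ord0, blk t1 i == blk1 w & (i < w.1.1)%N]].

Definition Psi1 (i : 'I_L) b :=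
  \xor_(w <- slabZ i) (b w && \xor_(z <- drop (nxt B t2 w.1.2) (row0 i)) b z).

Definition klad (p : 'I_L * 'I_L) := ladder (kline p).
Definition ksum_list := flatten [seq klad p | p <- enum (prod 'I_L 'I_L : finType)].

Lemma run_klad p b z : run (klad p) b z =
  if z.1 == p then \xor_(w <- drop (index z (kline p)) (kline p)) b w else b z.
Proof. by rewrite run_ladder ?kline_uniq // mem_kline. Qed.

Lemma run_klads r b z : uniq r ->
  run (flatten [seq klad p | p <- r]) b z = if z.1 \in r then run (klad z.1) b z else b z.
Proof.
elim: r b => [//|p r IH] b /= /andP[pr ur]; rewrite run_cat IH // inE !run_klad eqxx.
case: (eqVneq z.1 p) => [e|ne] /=; first by rewrite e (negbTE pr).
case: ifP => // _; apply: eq_big_seq => w /mem_drop; rewrite mem_kline => /eqP ew.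
by rewrite run_klad ew (negbTE ne).
Qed.

Lemma run_ksum b p : run ksum_list b (p, ord0) = \xor_k b (p, k).
Proof.
rewrite run_klads ?enum_uniq // mem_enum run_klad /= eqxx.
have -> : index (p, ord0 : 'I_L) (kline p) = 0%N.
  by rewrite /kline index_map ?index_enum_ord // => k k' [].
by rewrite drop0 big_map big_enum.
Qed.

(** [R1] ignores third coordinates, so summing over them turns each bit into the parity of its line,
    which [ksum_list] leaves in the plane of third coordinate zero. *)
Lemma Qf_R1 b : Qf (R1 B t1 t2) b = \xor_i Psi1 i (run ksum_list b).
Proof.
rewrite /Qf xor_site xor_pair; apply: eq_bigr => i _; rewrite /Psi1 xor_filter.
transitivity (\xor_q \xor_j \xor_k \xor_k' (R1 B t1 t2 ((i, j), k) (q, k') && (b ((i, j), k) && b (q, k')))).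
  rewrite [RHS]xor_xorC; apply: eq_bigr => j _; rewrite [RHS]xor_xorC; apply: eq_bigr => k _.
  by rewrite xor_site.
rewrite xor_site; apply: eq_bigr => q _.
have h0 (F : 'I_L -> bool) : \xor_k ((k == ord0) && F k) = F ord0 by exact: xor_delta_fin.
transitivity ([&& blk t1 i == blk t1 q.1, (i < q.1)%N & run ksum_list b (q, ord0) && \xor_(z <- drop (nxt B t2 q.2) (row0 i)) run ksum_list b z]).
  rewrite xor_drop -!xor_andr [RHS]xor_cond; apply: eq_bigr => j _.
  rewrite !run_ksum -!xor_andr; apply: eq_bigr => k _.
  rewrite [in RHS](andbC (\xor_k0 b (q, k0))) -!xor_andr; apply: eq_bigr => k' _.
  rewrite nxtP // /R1 /blk1 /blk2 /=.
  case: (blk t1 i == blk t1 q.1); rewrite /= ?andbF //.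
  by case: (_ < _)%N; case: (_ < _)%N; case: (b _); case: (b _).
(* Restores the sum over third coordinates with the indicator of [ord0] that [slabZ] carries. *)
rewrite -[LHS](h0 (fun k => [&& blk t1 i == blk t1 q.1, (i < q.1)%N & run ksum_list b (q, k) && \xor_(z <- drop (nxt B t2 q.2) (row0 i)) run ksum_list b z])).
by apply: eq_bigr => k _; rewrite -!andbA.
Qed.

(** Up to [B] rows per slab, each with two ladders and at most [B * L] controlled signs, again
    without the factor [L]. *)
Definition slab_cost := (B * (2 + B * czB))%N.

Lemma impl_Psi1 : impl [set: site L] (Dg (fun b => \xor_i Psi1 i b)) (slab_cost * L ^ 2) (slab_cost * L).
Proof.
pose f (i : 'I_L) := blk t1 i.
pose r := undup (map f (enum 'I_L)).
pose g := (B * (L.*2 + (B * L) * czB))%N.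
have h v : v \in r -> impl [set z : site L | f z.1.1 == v]
    (Dg (fun b => \xor_(p <- [seq p <- enum 'I_L | f p == v]) Psi1 p b)) g g.
  move=> _; rewrite -oprod_Dg.
  have hp p : p \in [seq p <- enum 'I_L | f p == v] ->
     impl [set z : site L | f z.1.1 == v] (Dg (Psi1 p)) (L.*2 + (B * L) * czB) (L.*2 + (B * L) * czB).
    rewrite mem_filter => /andP[/eqP fp _].
    have sZ : (size (slabZ p) <= B * L)%N.
      have := @size_filter_inj (site L) ('I_B * 'I_L)%type _ (fun w => (blk_offset t1 w.1.1, w.1.2)) _.
      rewrite !card_prod !card_ord; apply.
      move=> w w' /and3P[/eqP k1 /eqP h1 _] /and3P[/eqP k2 /eqP h1' _] [e1 e2].
      have {}e1 : w.1.1 = w'.1.1 by apply: (@blk_offset_inj t1); [rewrite -[LHS]h1 | apply/val_inj].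
      by case: w w' e1 e2 k1 k2 {h1 h1'} => [[? ?] ?] [[? ?] ?] /= -> -> -> ->.
    have hl := @impl_line_phase L [set z : site L | f z.1.1 == v] (row0 p) (slabZ p)
      (fun w => nxt B t2 w.1.2) (ord0, ord0, ord0) (3 * B) (row0_uniq p) (row0_near p).
    rewrite size_row0 in hl; apply: impl_le (hl _ _) (subxx _) _ _.
    - by move=> z /mapP[j _ ->]; rewrite inE /= fp.
    - move=> w; rewrite mem_filter => /andP[/and3P[/eqP h0 /eqP h1 h3] _]; split.
        by apply: contraTN h3 => /mapP[j _ ->]; rewrite ltnn.
      move=> /(nth_row0 p)[k -> ek]; split.
        apply/subsetP => z; rewrite !inE /= => /and3P[m1 _ _].
        by rewrite -fp; apply/eqP; apply: blk_mid m1 => //; rewrite -[LHS]h1.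
      rewrite /l1 /= ek h0; have := nxt_dist B0 t2 w.1.2.
      have := blk_dist B0 h1; have -> : absd (ord0 : 'I_L) (ord0 : 'I_L) = 0%N by [].
      by move: (absd p _) (absd (nxt _ _ _) _) => u1 u2; lia.
    - by rewrite leq_add2l leq_mul2r sZ orbT.
    - by rewrite leq_add2l leq_mul2r sZ orbT.
  have sv : (size [seq p <- enum 'I_L | f p == v] <= B)%N.
    have := @size_filter_inj 'I_L 'I_B _ (fun p => blk_offset t1 p) _.
    rewrite !card_ord; apply.
    move=> p p' /eqP hp1 /eqP hp2 e1.
    by apply: (@blk_offset_inj t1) => //; rewrite -/(f p) -/(f p') hp1 hp2.
  by apply: impl_le (impl_seq_big hp) (subxx _) _ _; rewrite leq_mul2r sv orbT.
have hr := impl_par_big (f := fun z : site L => f z.1.1) (undup_uniq _) h.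
rewrite oprod_Dg in hr.
rewrite (eq_Dg (q := fun b => \xor_(v <- r) \xor_(p <- [seq p <- enum 'I_L | f p == v]) Psi1 p b)); last first.
  by move=> b; rewrite (xor_partition f).
have sr : (size r <= L)%N.
  by rewrite (leq_trans (size_undup _)) // size_map -cardE card_ord.
have gE : g = (slab_cost * L)%N by rewrite /g /slab_cost -mul2n; lia.
apply: impl_le hr (subsetT _) _ _; last by rewrite gE.
rewrite gE !expnS expn0 muln1; apply: leq_trans (leq_mul sr (leqnn _)) _.
by move: slab_cost L => u v; nia.
Qed.

Lemma oprod_run (T : Type) (c : T -> seq (site L * site L)) (s : seq T) :
  oprod (fun p => Pm (run (c p))) s = Pm (run (flatten (map c s))).
Proof.
elim: s => [|p s IH]; first by rewrite -[LHS]Mn1.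
by rewrite oprod_cons IH PmM; apply: eq_Mn => // b; rewrite /= run_cat.
Qed.

Lemma impl_klines (c : 'I_L * 'I_L -> seq (site L * site L)) s :
  (forall p, all (fun e => [&& near e, e.1 \in kline p & e.2 \in kline p]) (c p)) ->
  (forall p, (size (c p) <= L)%N) -> uniq s ->
  impl [set: site L] (Pm (run (flatten (map c s)))) (L ^ 3) L.
Proof.
move=> hc sc us; rewrite -oprod_run.
have h p : p \in s -> impl [set z : site L | z.1 == p] (Pm (run (c p))) L L.
  move=> _; apply: impl_le (impl_run (S := [set z : site L | z.1 == p]) _) (subxx _) _ _ => //.
  by apply: sub_all (hc p) => e; rewrite !mem_kline !inE.
apply: impl_le (impl_par_big (f := fun z : site L => z.1) us h) (subsetT _) _ _ => //.
have : (size s <= L * L)%N by rewrite -(card_uniqP us) (leq_trans (max_card _)) // card_prod card_ord.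
by rewrite !expnS expn0 muln1 mulnA => hs; rewrite leq_mul2r hs orbT.
Qed.

(** The summand 2 pays for collecting the line parities and for undoing it. *)
Definition order_cost := (2 + slab_cost + col_cost)%N.

Lemma impl_qt : impl [set: site L] (Dg (qt B t1 t2 t3)) (order_cost * L ^ 3) (order_cost * L).
Proof.
have hk p : all (fun e => [&& near e, e.1 \in kline p & e.2 \in kline p]) (klad p).
  apply/allP => e ep; have [h1 h2] := mem_ladder ep.
  by rewrite h1 h2 (allP (kline_near p)).
have sk p : (size (klad p) <= L)%N by rewrite (leq_trans (size_ladder _)) // size_kline.
have i1 : impl [set: site L] (Pm (run ksum_list)) (L ^ 3) L by apply: impl_klines => //; apply: enum_uniq.
have i2 : impl [set: site L] (Pm (run (rev ksum_list))) (L ^ 3) L.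
  rewrite rev_flatten -map_rev -map_rev -map_comp.
  apply: impl_klines => [p|p|]; rewrite ?rev_uniq ?enum_uniq //=; first by rewrite all_rev.
  by rewrite size_rev.
have i3 := impl_conj i1 i2 impl_Psi1.
rewrite Pm_conj in i3; last first.
  apply: run_revK; apply/allP => e /flattenP[l /mapP[p _ ->]] el.
  exact: (allP (kline_near p)).
have i4 := impl_seq i3 impl_R2.
have -> : Dg (qt B t1 t2 t3) = Dg (Qf (R2 B t1 t2 t3)) *m Dp (fun b => sgn (\xor_i Psi1 i (run ksum_list b))).
  by rewrite DpM; apply: eq_Dp => b; rewrite sgnM /qt Qf_R1 addbC.
apply: impl_le i4 (subxx _) _ _.
  rewrite /order_cost -mul2n !mulnDl !leq_add //.
  by rewrite leq_mul2l leq_pexp2l ?orbT.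
by rewrite /order_cost -mul2n !mulnDl.
Qed.
End Slabs.
Lemma uniq_flatten_key (T K : eqType) (k : T -> K) (F : K -> seq T) (r : seq K) :
  (forall v, uniq (F v)) -> (forall v p, p \in F v -> k p = v) -> uniq r ->
  uniq (flatten [seq F v | v <- r]).
Proof.
move=> uF kF; elim: r => //= v r IH /andP[vr ur]; rewrite cat_uniq uF IH // andbT.
apply/hasPn => p /flatten_mapP[w wr pw]; apply: contraNN vr => /kF <-.
by rewrite (kF _ _ pw).
Qed.

(** * The Jordan-Wigner isometry *)

Section JordanWigner.
Variable L : nat.
Implicit Types (x y z : site L) (Phi E H : Op L).

Lemma card_site : #|site L| = (L ^ 3)%N.
Proof. by rewrite !card_prod !card_ord !expnS expn0 muln1 mulnA. Qed.

Definition rank_order z : 'I_(L ^ 3) := cast_ord card_site (enum_rank z).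

Lemma rank_order_canonical : canonical_ordering rank_order.
Proof.
exists (fun i => enum_val (cast_ord (esym card_site) i)) => i.
  by rewrite /rank_order cast_ordK enum_rankK.
by rewrite /rank_order enum_valK cast_ordKV.
Qed.

Lemma Zstring_rank x : Zstring rank_order x = Dg (sig (@r0 L) x).
Proof.
have h s : foldr mulmx 1%:M [seq onsite y PZ | y <- s] = Dg (fun b : cfg L => \xor_(y <- s) b y).
  elim: s => [|y s IH] /=; first by rewrite -Dg0; apply: eq_Dg => b; rewrite big_nil.
  have -> : PZ = diag2 1 (-1).
    apply/matrixP => i j; rewrite !mxE; case: eqP => // _.
  rewrite IH onsite_diag.
  have -> : Dp (fun b : cfg L => if b y then (-1 : C) else 1) = Dg (fun b => b y) by [].
  by rewrite DgM; apply: eq_Dg => b; rewrite big_cons.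
rewrite /Zstring h; apply: eq_Dg => b; rewrite /sig big_enum_cond /= [LHS]big_mkcond /=.
by apply: eq_bigr => y _; rewrite inE andbT -/(r0 y x); case: (r0 y x).
Qed.

(** [(X + iY) / 2] lowers the bit at [x], and the string of [Z] along [rank_order] is the sign in
    [c_op]. Fock and qubit bases share their index set, so the intertwining relation of [Phi]
    becomes commutation with the ladder operators. *)
Lemma JW_c_op x :
  ((2%:R : C)^-1 *: (onsite x PX + iC *: onsite x PY)) *m Zstring rank_order x = c_op x.
Proof.
rewrite Zstring_rank c_opE; apply: ent_ext => a b; rewrite ent_Dp_r ent_Mn.
have -> : ent ((2%:R : C)^-1 *: (onsite x PX + iC *: onsite x PY)) a b =
   2%:R^-1 * (ent (onsite x PX) a b + iC * ent (onsite x PY) a b) by rewrite /ent !mxE.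
rewrite !onsite_ent -/(eqoff x a b).
have b0 (v : bool) : (bit v : nat) = v by rewrite /= inordK; case: v.
have -> : (a == flip b x) = eqoff x a b && (a x == ~~ b x).
  apply/eqP/andP => [->|[/eqoffP e /eqP ex]].
    by rewrite flip_at eqxx; split=> //; apply/eqoffP => z zx; rewrite flip_ne.
  by apply/ffunP => z; case: (eqVneq z x) => [->|zx]; rewrite ?flip_at // flip_ne // e.
case: (eqoff x a b) => /=; last by rewrite mulr0 addr0 mulr0 mul0r.
have ii : iC * iC = -1 by rewrite -expr2 iC2.
rewrite !mxE !b0 (inj_eq bit_inj); case: (a x); case: (b x) => /=;
  rewrite ?mulr0 ?addr0 ?mulr0 ?mul0r ?ii ?subrr ?mulr0 ?mul0r //.
rewrite mulrN ii opprK -[1 + 1]/(2%:R) mulVf ?mul1r //.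
by rewrite pnatr_eq0.
Qed.

Lemma JW_comm Phi g x : isJW rank_order Phi -> (g == c_op x) || (g == cdag x) -> Phi *m g = g *m Phi.
Proof.
move=> [[u1 u2] [_ h]]; have {}h := h x; rewrite JW_c_op in h.
case/orP=> /eqP->; first by rewrite -{2}h -!mulmxA u2 mulmx1.
have h' : Phi *m cdag x *m adj Phi = cdag x.
  by rewrite /cdag -{2}h !adjM adjK mulmxA.
by rewrite -{2}h' -!mulmxA u2 mulmx1.
Qed.

Lemma oprod_comm (T : eqType) (U : T -> Op L) s Phi :
  (forall p, p \in s -> Phi *m U p = U p *m Phi) -> Phi *m oprod U s = oprod U s *m Phi.
Proof.
elim: s => [|p s IH] h; first by rewrite /oprod /= mulmx1 mul1mx.
rewrite oprod_cons mulmxA IH; last by move=> w ws; apply: h; rewrite inE ws orbT.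
by rewrite -!mulmxA h // mem_head.
Qed.

End JordanWigner.

(** * The schedule *)

Section Assembly.
Variables (L' delta : nat).
Let L := L'.+1.
Let B := delta.+1.
Let B0 : (0 < B)%N := ltn0Sn delta.
Implicit Types (x y z u w : site L) (p : {set site L}).

Definition shift := prod (prod 'I_B 'I_B) 'I_B : finType.
Implicit Type t : shift.

Definition bidx t z : nat * nat * nat :=
  (blk1 B t.1.1 z, blk2 B t.1.2 z, blk3 B t.2 z).
Definition bset t v : {set site L} := [set z | bidx t z == v].

Lemma coord_shift (q r : nat) : (absd q r <= delta)%N -> exists t : 'I_B, blk B t q = blk B t r.
Proof.
have h (q' r' : nat) : (q' <= r' <= q' + delta)%N -> exists t : 'I_B, blk B t q' = blk B t r'.
  (* Since [q' + q' * delta] is a multiple of [B], this shift makes [q'] the first site of a block,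
     and [r'] lies less than [B] further on. *)
  move=> /andP[h1 h2]; exists (Ordinal (ltn_pmod (q' * delta) B0)); rewrite /blk /=.
  have /dvdnP[k e] : (B %| q' + (q' * delta) %% B)%N.
    by rewrite /dvdn modnDmr -{1}[q']muln1 -mulnDr add1n modnMl.
  have -> : (r' + (q' * delta) %% B = k * B + (r' - q'))%N by lia.
  by rewrite e mulnK // divnMDl // divn_small ?addn0 //; lia.
move=> d; case: (leqP q r) => qr; first by apply: h; rewrite /absd in d; lia.
by have [|t e] := h r q; [rewrite /absd in d; lia | exists t].
Qed.

Lemma shift_exists x y : (linf x y <= delta)%N -> exists t, bidx t x = bidx t y.
Proof.
rewrite /linf !geq_max => /andP[/andP[h1 h2] h3].
have [t1 e1] := coord_shift h1; have [t2 e2] := coord_shift h2; have [t3 e3] := coord_shift h3.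
by exists (t1, t2, t3); rewrite /bidx /blk1 /blk2 /blk3 /= e1 e2 e3.
Qed.

Lemma bset_convex t v u w : u \in bset t v -> w \in bset t v ->
  box u w \subset bset t v /\ (l1 u w <= 3 * B)%N.
Proof.
rewrite !inE => /eqP <- /eqP [e1 e2 e3]; split.
  apply/subsetP => z; rewrite !inE => /and3P[m1 m2 m3]; apply/eqP.
  by rewrite /bidx /blk1 /blk2 /blk3 (blk_mid B0 (erefl _) e1 m1) (blk_mid B0 (erefl _) e2 m2) (blk_mid B0 (erefl _) e3 m3).
have := blk_dist B0 e1; have := blk_dist B0 e2; have := blk_dist B0 e3; rewrite /l1 /absd; lia.
Qed.

Lemma card_bset t v : (#|bset t v| <= B ^ 3)%N.
Proof.
have := @leq_card_in (site L) ('I_B * 'I_B * 'I_B)%type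
  (fun z => (blk_offset B0 t.1.1 z.1.1, blk_offset B0 t.1.2 z.1.2, blk_offset B0 t.2 z.2)) (mem (bset t v)) _.
rewrite !card_prod !card_ord !expnS expn0 muln1 mulnA; apply.
move=> z w; rewrite !inE => /eqP hz /eqP hw [e1 e2 e3].
have [h1 h2 h3] : bidx t z = bidx t w by rewrite hz hw.
have {}e1 : z.1.1 = w.1.1 by apply: (blk_offset_inj h1); apply/val_inj.
have {}e2 : z.1.2 = w.1.2 by apply: (blk_offset_inj h2); apply/val_inj.
have {}e3 : z.2 = w.2 by apply: (blk_offset_inj h3); apply/val_inj.
by case: z w e1 e2 e3 {hz hw h1 h2 h3} => [[? ?] ?] [[? ?] ?] /= -> -> ->.
Qed.

(** Several shifts may fit a pair; picking one places it in exactly one stage. For members of [P]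
    the default is never reached. *)
Definition tkey p : shift := odflt (ord0, ord0, ord0)
  [pick t : shift | [forall x in p, forall y in p, bidx t x == bidx t y]].
Definition vkey p := bidx (tkey p) (odflt (ord0, ord0, ord0) [pick z in p]).

Lemma inP_key p : inP delta p -> exists x y, [/\ x != y, (linf x y <= delta)%N, p = [set x; y],
  bidx (tkey p) x = vkey p & bidx (tkey p) y = vkey p].
Proof.
move=> /existsP[x /existsP[y /and3P[xy h /eqP ep]]]; exists x, y.
have same z w : z \in p -> w \in p -> bidx (tkey p) z = bidx (tkey p) w.
  rewrite /tkey; case: pickP => [t /forall_inP ht zp wp|none].
    by apply/eqP; have /forall_inP := ht z zp; apply.
  have [t e] := shift_exists h; case/negP: (negbT (none t)).
  apply/forall_inP => u up; apply/forall_inP => u' up'.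
  move: up up'; rewrite ep !inE.
  by move=> /orP[]/eqP-> /orP[]/eqP->; rewrite ?e.
have xp : x \in p by rewrite ep !inE eqxx.
have yp : y \in p by rewrite ep !inE eqxx orbT.
split=> //; rewrite /vkey; case: pickP => [z zp|none]; try exact: same;
 by have := none x; rewrite xp.
Qed.

Definition pairs t v := [seq p <- enum {: {set site L}} | [&& inP delta p, tkey p == t & vkey p == v]].
Definition blocks t := undup [seq bidx t z | z <- enum (site L)].
Definition stage t := flatten [seq pairs t v | v <- blocks t].
Definition schedule := flatten [seq stage t | t <- enum shift].

Lemma stage_key t p : p \in stage t -> tkey p = t.
Proof.
by move=> /flatten_mapP[v _]; rewrite mem_filter => /andP[/and3P[_ /eqP]].
Qed.

Lemma schedule_enumerates : enumerates delta schedule.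
Proof.
split.
  apply: (uniq_flatten_key (k := tkey)) (enum_uniq _) => [t|t p]; last exact: stage_key.
  apply: (uniq_flatten_key (k := vkey)) (undup_uniq _) => [v|v p].
    by rewrite filter_uniq ?enum_uniq.
  by rewrite mem_filter => /andP[/and3P[_ _ /eqP]].
move=> p; apply/flatten_mapP/idP => [[t _ /flatten_mapP[v _]]|pP].
  by rewrite mem_filter => /andP[/and3P[]].
exists (tkey p); first by rewrite mem_enum.
apply/flatten_mapP; exists (vkey p); last by rewrite mem_filter pP !eqxx mem_enum.
by have [x [y [_ _ _ <- _]]] := inP_key pP; rewrite mem_undup map_f ?mem_enum.
Qed.

(** The pairs of a block are among its [2 ^ (B ^ 3)] subsets at most. *)
Definition block_cost := (2 ^ (B ^ 3) * pair_cost (B ^ 3) (3 * B))%N.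
Definition stage_cost := (2 * order_cost B + block_cost)%N.

Variables (H : {set site L} -> Op L) (theta : {set site L} -> RR) (E : {set site L} -> Op L).
Hypothesis hH : forall x y, x != y -> (linf x y <= delta)%N ->
  is_hermitian (H [set x; y]) /\ parity_even x y (H [set x; y]) /\
  in_gen_algebra [:: c_op x; cdag x; c_op y; cdag y] (H [set x; y]).
Hypothesis hE : forall x y, x != y -> (linf x y <= delta)%N ->
  is_expm ((- (iC * ofR (theta [set x; y]))) *: H [set x; y]) (E [set x; y]).

Let q t := qt (L := L) B t.1.1 t.1.2 t.2.

Lemma impl_block t v : impl (bset t v)
  (oprod (fun p => Dg (q t) *m E p *m Dg (q t)) (pairs t v)) block_cost block_cost.
Proof.
pose c := pair_cost (B ^ 3) (3 * B).
have sub p : p \in pairs t v -> p \in powerset (bset t v).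
  rewrite mem_filter => /andP[/and3P[/inP_key[x [y [_ _ ep ex ey]]] /eqP et /eqP ev] _].
  by rewrite inE ep subUset !sub1set !inE -et -ev ex ey eqxx.
have h p : p \in pairs t v -> impl (bset t v) (Dg (q t) *m E p *m Dg (q t)) c c.
  move=> pp; have := sub p pp; move: pp.
  rewrite mem_filter => /andP[/and3P[/inP_key[x [y [xy dxy ep ex ey]]] /eqP et /eqP ev] _].
  rewrite ep inE subUset !sub1set => /andP[xS yS].
  have [h1 [h2 h3]] := hH xy dxy.
  have := impl_E (n := 3 * B) xy h1 h2 h3 (hE xy dxy) xS yS (@bset_convex t v)
    (@qt_flip L B t.1.1 t.1.2 t.2 B0).
  move=> hh; apply: impl_le (hh _) (subxx _) _ _.
  - move=> z; rewrite inE => zv; move: xS yS zv; rewrite !inE => /eqP <- /eqP [e1 e2 e3] zv.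
    apply: rb_block; rewrite ?e1 ?e2 ?e3 //.
    by move: zv; rewrite /bidx !xpair_eqE -andbA.
  - by rewrite /c /pair_cost leq_add2r !leq_mul // card_bset.
  - by rewrite /c /pair_cost leq_add2r !leq_mul // card_bset.
have sz : (size (pairs t v) <= 2 ^ (B ^ 3))%N.
  have up : uniq (pairs t v) by rewrite filter_uniq ?enum_uniq.
  rewrite -(card_uniqP up); apply: leq_trans (_ : #|powerset (bset t v)| <= _)%N.
    by apply: subset_leq_card; apply/subsetP => p /sub.
  by rewrite card_powerset leq_exp2l // card_bset.
by apply: impl_le (impl_seq_big h) (subxx _) _ _; rewrite leq_mul2r sz orbT.
Qed.

Lemma impl_stage t : impl [set: site L] (oprod E (stage t)) (stage_cost * L ^ 3) (stage_cost * L).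
Proof.
have qq := DgK (q t).
have h v : v \in blocks t -> impl [set z | bidx t z == v]
    (oprod (fun p => Dg (q t) *m E p *m Dg (q t)) (pairs t v)) block_cost block_cost.
  by move=> _; exact: impl_block.
have hp := impl_par_big (f := bidx t) (undup_uniq _) h.
rewrite -oprod_flatten oprod_conj // in hp.
have {}hp := impl_le hp (subsetT _) (leqnn _) (leqnn _).
have hq := @impl_qt L' B t.1.1 t.1.2 t.2 B0.
have := impl_conj hq hq hp.
(* The outer circuits for [Dg (q t)] cancel the conjugation, leaving the bare product over the
   stage. *)
rewrite !mulmxA DgK mul1mx -mulmxA DgK mulmx1 => hh.
have sb : (size (blocks t) <= L ^ 3)%N.
  by rewrite (leq_trans (size_undup _)) // size_map -cardE card_site.
apply: impl_le hh (subxx _) _ _; rewrite /stage_cost mulnDl -mul2n -mulnA leq_add2l.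
  by rewrite mulnC leq_mul2l sb orbT.
by rewrite leq_pmulr.
Qed.

Lemma impl_schedule : impl [set: site L] (oprod E schedule)
  (B ^ 3 * stage_cost * L ^ 3) (B ^ 3 * stage_cost * L).
Proof.
rewrite oprod_flatten.
have h t : t \in enum shift -> impl [set: site L] (oprod E (stage t)) (stage_cost * L ^ 3) (stage_cost * L).
  by move=> _; exact: impl_stage.
have := impl_seq_big h; rewrite -cardE !card_prod !card_ord !mulnA.
by rewrite !expnS expn0 muln1 !mulnA.
Qed.

Lemma JW_schedule_comm Phi : isJW (@rank_order L) Phi ->
  Phi *m oprod E schedule = oprod E schedule *m Phi.
Proof.
move=> jw; apply: oprod_comm => p; rewrite schedule_enumerates.2.
move=> /inP_key[x [y [xy dxy -> _ _]]]; have [_ [_ h3]] := hH xy dxy.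
apply: (comm_E (hE xy dxy)); apply: gen_algebra_comm h3 _ => g.
by rewrite !inE => /or4P[]h; [apply: (JW_comm (x := x)) | apply: (JW_comm (x := x))
  | apply: (JW_comm (x := y)) | apply: (JW_comm (x := y))]; rewrite ?h ?orbT.
Qed.

End Assembly.

Theorem mainTheorem14 (δ : nat) : (1 <= δ)%N ->
  exists K : nat, forall (L : nat)
    (Phi : (site L -> 'I_(L ^ 3)) -> Op L),
    (forall m, canonical_ordering m -> isJW m (Phi m)) ->
    forall (H : {set site L} -> Op L) (θ : {set site L} -> RR)
           (E : {set site L} -> Op L),
    (forall x y : site L, x != y -> (linf x y <= δ)%N ->
       is_hermitian (H [set x; y]) /\ parity_even x y (H [set x; y]) /\
       in_gen_algebra [:: c_op x; cdag x; c_op y; cdag y] (H [set x; y])) ->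
    (forall x y : site L, x != y -> (linf x y <= δ)%N ->
       is_expm ((- (iC * ofR (θ [set x; y]))) *: H [set x; y]) (E [set x; y])) ->
    exists (m0 m1 : site L -> 'I_(L ^ 3)) (s : seq {set site L}) (V : circuit L),
      canonical_ordering m0 /\ canonical_ordering m1 /\ enumerates δ s /\
      circuit_ok V /\
      (gate_count V <= K * L ^ 3)%N /\ (circuit_depth V <= K * L)%N /\
      circuit_op V *m Phi m0 = Phi m1 *m ordered_prod E s.
Proof.
(* One stage for each of the [δ.+1 ^ 3] shifts. *)
move=> _; exists (δ.+1 ^ 3 * stage_cost δ)%N => L Phi hPhi H θ E hH hE.
have cm := rank_order_canonical L; exists (@rank_order L), (@rank_order L).
case: L Phi hPhi H θ E hH hE cm => [|L'] Phi hPhi H θ E hH hE cm.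
  (* Without sites there are no pairs, and the empty circuit suffices. *)
  exists [::], [::]; do !split=> //.
    move=> p; symmetry; apply/negbTE/existsPn => x.
    by case: (x.2) => k; rewrite ltn0.
  by rewrite mul1mx mulmx1.
have [V [V1 _ V2 V3 V4]] := impl_schedule hH hE.
exists (schedule L' δ), V.
refine (conj cm (conj cm (conj (schedule_enumerates L' δ) (conj V1 (conj V3 (conj V4 _)))))).
by rewrite V2 -(JW_schedule_comm hH hE (hPhi _ cm)).
Qed.
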